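(* Let $K$ be an algebraically closed field and let $X,Y\in\mathcal{S}_1(K)$. The object $Y\ast X$ computed by the Algorithm described in the context (with input $X,Y$) is the generic extension of $Y$ by $X$; that is, $Y\ast X$ is the unique (up to isomorphism) extension of $Y$ by $X$ in $\mathcal{S}_1$ with minimal $K$-dimension of its endomorphism ring $\operatorname{End}_{\mathcal{S}}$ among all extensions of $Y$ by $X$ in $\mathcal{S}_1$.
   Context: For a partition $\lambda=(\lambda_1\ge\lambda_2\ge\dots)$ put $N_\lambda=\bigoplus_iK[T]/(T^{\lambda_i})$; $\ell(\lambda)$ is the number of nonzero parts, $\lambda_i=0$ for $i>\ell(\lambda)$. $\mathcal{S}$ is the category of triples $(N_\alpha,N_\beta,f)$ with $f:N_\alpha\to N_\beta$ an injective $K[T]$-homomorphism; morphisms $(N_\alpha,N_\beta,f)\to(N_{\alpha'},N_{\beta'},f')$ are pairs $(\psi_1,\psi_2)$ of $K[T]$-homomorphisms with $f'\psi_1=\psi_2f$. $\mathcal{S}_1$ is the full subcategory of objects with $\alpha_1\le1$. Every indecomposable object of $\mathcal{S}_1$ is isomorphic to $P_0^m=(0,N_{(m)},0)$ or $P_1^m=(N_{(1)},N_{(m)},\iota)$, $\iota(1)=T^{m-1}$, $m\ge1$. An object $X$ of $\mathcal{S}_1$ is determined up to isomorphism by a pair of partitions $(\gamma^X,\beta^X)$ with $\gamma^X_i\le\beta^X_i\le\gamma^X_i+1$ for all $i$: $X\cong\bigoplus_{i\le\ell(\beta^X)}P_{\varepsilon_i}^{\beta^X_i}$ with $\varepsilon_i=\beta^X_i-\gamma^X_i$.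 An object $Z\in\mathcal{S}_1$ is an extension of $Y$ by $X$ if there is a short exact sequence $0\to X\to Z\to Y\to0$ (exact in both components). Algorithm. Input: $X,Y\in\mathcal{S}_1$ given by $(\gamma^X,\beta^X)$, $(\gamma^Y,\beta^Y)$. Put $p=\ell(\beta^X)$, $q=\ell(\beta^Y)$, $m=\min\{p,q\}$. Output: $Z=Y\ast X$, given by $(\gamma^Z,\beta^Z)$ computed as follows. Step 1: $\gamma^Z=\gamma^X+\gamma^Y$ (componentwise sum). Step 2: set $n=0$. Step 3: for $i=1,\dots,m$ put $\beta^Z_i=\beta^X_i+\gamma^Y_i$, and if $\beta^Y_i\ne\gamma^Y_i$ replace $n$ by $n+1$. Step 4: if $p>m$, then for $i=m+1,\dots,p$ put $\beta^Z_i=\beta^X_i$; otherwise, for $i=m+1,\dots,q$ in increasing order, let $\delta=1$ if $\gamma^Y_i=\beta^Y_i$ and $n>0$ (current value of $n$), and $\delta=0$ otherwise; put $\beta^Z_i=\beta^Y_i+\delta$ and replace $n$ by $n-\delta$. Step 5: append to $\beta^Z$ exactly $n$ further parts equal to $1$ (current value of $n$). *)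

(* Defs.v *)
From HB Require Import structures.
From mathcomp Require Import all_boot all_algebra.

Set Implicit Arguments.
Unset Strict Implicit.
Unset Printing Implicit Defensive.

Import GRing.Theory.

(* A partition is the weakly decreasing sequence of its nonzero parts, so that
   its length is [size l]; the (i+1)-st part is [nth 0 l i], which is 0 beyond
   the length. *)
Definition is_part (l : seq nat) : bool := sorted geq l && (0 \notin l).

(* Pairs (gamma, beta) with gamma_i <= beta_i <= gamma_i + 1 for all i. *)
Definition S1_pair (g b : seq nat) : Prop :=
  [/\ is_part g, is_part b &
      forall i, nth 0 g i <= nth 0 b i <= (nth 0 g i).+1].

(* The algorithm. Indices are shifted by one (i runs from 0); the state [st]
   is the pair formed by the parts of beta^Z produced so far and the current
   value of n. *)
Section Algorithm.

Variables gX bX gY bY : seq nat.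

Let p := size bX.
Let q := size bY.
Let m := minn p q.

Definition step1 : seq nat :=
  mkseq (fun i => nth 0 gX i + nth 0 gY i) (maxn (size gX) (size gY)).

Definition step3 (st : seq nat * nat) (i : nat) : seq nat * nat :=
  (rcons st.1 (nth 0 bX i + nth 0 gY i),
   if nth 0 bY i != nth 0 gY i then st.2.+1 else st.2).

Definition step4_X (st : seq nat * nat) (i : nat) : seq nat * nat :=
  (rcons st.1 (nth 0 bX i), st.2).

Definition step4_Y (st : seq nat * nat) (i : nat) : seq nat * nat :=
  let delta : nat :=
    if (nth 0 gY i == nth 0 bY i) && (0 < st.2) then 1 else 0 in
  (rcons st.1 (nth 0 bY i + delta), st.2 - delta).

Definition algo_gamma : seq nat := step1.

Definition algo_beta : seq nat :=
  let st2 := ([::], 0) in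
  let st3 := foldl step3 st2 (iota 0 m) in
  let st4 := if m < p then foldl step4_X st3 (iota m (p - m))
             else foldl step4_Y st3 (iota m (q - m)) in
  st4.1 ++ nseq st4.2 1.

End Algorithm.

Local Open Scope ring_scope.

(* [kmod K l] is N_l, the direct sum of the K[T]/(T^l_i), as a K-vector space.
   [{poly %/ 'X^m}] is K[T]/(T^m) only for 0 < m, hence the requirement in
   [is_part] that all parts be nonzero. *)
Fixpoint kmod (K : fieldType) (l : seq nat) : vectType K :=
  if l is m :: l' then ({poly %/ ('X^m : {poly K})} * kmod K l')%type
  else 'rV[K]_0.

(* The action of K[T] on N_l. *)
Fixpoint act (K : fieldType) (r : {poly K}) (l : seq nat) :
    kmod K l -> kmod K l :=
  match l return kmod K l -> kmod K l with
  | [::] => id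
  | m :: l' => fun x => (in_qpoly 'X^m r * x.1, act r x.2)
  end.

(* Being K-linear is part of the type of [f]. *)
Definition KT_hom (K : fieldType) (a b : seq nat)
    (f : 'Hom(kmod K a, kmod K b)) : Prop :=
  forall (r : {poly K}) x, f (act r x) = act r (f x).

Record triple (K : fieldType) := Triple {
  al : seq nat;
  be : seq nat;
  emb : 'Hom(kmod K al, kmod K be)
}.
Arguments Triple {K}.

Definition in_S (K : fieldType) (X : triple K) : Prop :=
  [/\ is_part (al X), is_part (be X), injective (emb X) & KT_hom (emb X)].

Definition in_S1 (K : fieldType) (X : triple K) : Prop :=
  in_S X /\ (nth 0 (al X) 0 <= 1)%N.

Definition morphism (K : fieldType) (X Y : triple K)
    (u : 'Hom(kmod K (al X), kmod K (al Y))
         * 'Hom(kmod K (be X), kmod K (be Y))) : Prop :=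
  [/\ KT_hom u.1, KT_hom u.2 & (emb Y \o u.1 = u.2 \o emb X)%VF].

Definition iso (K : fieldType) (X Y : triple K) : Prop :=
  exists u v, [/\ @morphism K X Y u, @morphism K Y X v,
    (v.1 \o u.1 = \1)%VF /\ (v.2 \o u.2 = \1)%VF &
    (u.1 \o v.1 = \1)%VF /\ (u.2 \o v.2 = \1)%VF].

(* 0 -> X -> Z -> Y -> 0 *)
Definition short_exact (K : fieldType) (X Z Y : triple K) u v : Prop :=
  [/\ @morphism K X Z u, @morphism K Z Y v,
    [/\ lker u.1 = 0%VS, limg u.1 = lker v.1 & limg v.1 = fullv] &
    [/\ lker u.2 = 0%VS, limg u.2 = lker v.2 & limg v.2 = fullv]].

(* Z is an extension, inside S_1, of Y by X. *)
Definition extension (K : fieldType) (Y X Z : triple K) : Prop :=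
  in_S1 Z /\ exists u v, @short_exact K X Z Y u v.

Section EndSpace.

Variable K : fieldType.

Lemma qpoly_scalerAr (h : {poly K}) a (x y : {poly %/ h}) :
  x * (a *: y) = a *: (x * y).
Proof. exact/esym/scalerAr. Qed.

Lemma qpoly_scalerAl (h : {poly K}) a (x y : {poly %/ h}) :
  (a *: x) * y = a *: (x * y).
Proof. exact/esym/scalerAl. Qed.

Lemma act_linear (r : {poly K}) l : linear (@act K r l).
Proof.
elim: l => [|m l IH] a x y //=.
by rewrite IH mulrDr qpoly_scalerAr.
Qed.

HB.instance Definition _ (r : {poly K}) l :=
  GRing.isLinear.Build K (kmod K l) (kmod K l) *:%R (@act K r l)
    (@act_linear r l).

Definition Tmul (l : seq nat) : 'End(kmod K l) := linfun (@act K 'X l).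

Lemma actD (r s : {poly K}) l x : @act K (r + s) l x = act r x + act s x.
Proof.
elim: l x => [|m l IH] x /=; last by rewrite IH in_qpolyD mulrDl.
by apply/rowP; case.
Qed.

Lemma actM (r s : {poly K}) l x : @act K (r * s) l x = act r (act s x).
Proof. by elim: l x => [//|m l IH] x /=; rewrite IH in_qpolyM mulrA. Qed.

Lemma actC (c : K) l x : @act K c%:P l x = c *: x.
Proof.
elim: l x => [|m l IH] x /=; first by apply/rowP; case.
rewrite IH -[c%:P]mulr1 mul_polyC in_qpolyZ in_qpoly1.
by rewrite qpoly_scalerAl mul1r; case: x.
Qed.

Lemma KT_homP a b (f : 'Hom(kmod K a, kmod K b)) :
  (f \o Tmul a)%VF = (Tmul b \o f)%VF <-> KT_hom f.
Proof.
split=> [cfT r|cf]; last by apply/lfunP=> x; rewrite !comp_lfunE !lfunE cf.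
have cT x : f (act 'X x) = act 'X (f x).
  by have /lfunP/(_ x) := cfT; rewrite !comp_lfunE !lfunE.
elim/poly_ind: r => [|r c IH] x.
  by rewrite -[0]/((0 : K)%:P) !actC linearZ.
by rewrite !actD !actM !actC linearD linearZ /= IH cT.
Qed.

Section Fix_X.

Variable X : triple K.
Let A := kmod K (al X).
Let B := kmod K (be X).

(* Vanishes exactly on the endomorphisms of X. *)
Definition end_defect (u : ('End(A) * 'End(B))%type) :
    ('End(A) * 'End(B) * 'Hom(A, B))%type :=
  ((u.1 \o Tmul (al X))%VF - (Tmul (al X) \o u.1)%VF,
   (u.2 \o Tmul (be X))%VF - (Tmul (be X) \o u.2)%VF,
   (emb X \o u.1)%VF - (u.2 \o emb X)%VF).

Lemma end_defect_linear : linear end_defect.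
Proof.
have sub (V : lmodType K) a (x y z t : V) :
    a *: x + y - (a *: z + t) = a *: (x - z) + (y - t).
  by rewrite scalerBr opprD addrACA.
move=> a u v; congr (_, _, _); apply/lfunP=> x;
  rewrite /= !(add_lfunE, opp_lfunE, scale_lfunE, comp_lfunE) linearP;
  exact: sub.
Qed.

HB.instance Definition _ :=
  GRing.isLinear.Build K ('End(A) * 'End(B))%type
    ('End(A) * 'End(B) * 'Hom(A, B))%type *:%R end_defect end_defect_linear.

Definition EndS : {vspace ('End(A) * 'End(B))%type} := lker (linfun end_defect).

Lemma mem_EndS u : u \in EndS <-> @morphism K X X u.
Proof.
rewrite memv_ker lfunE /= /end_defect; split.
  move/eqP=> [/subr0_eq h1 /subr0_eq h2 /subr0_eq h3].
  by split=> //; apply/KT_homP.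
by case=> /KT_homP h1 /KT_homP h2 h3; rewrite h1 h2 h3 !subrr.
Qed.

End Fix_X.

End EndSpace.

Definition minimal_extension (K : fieldType) (Y X Z : triple K) : Prop :=
  extension Y X Z /\
  forall Z', extension Y X Z' -> (\dim (EndS Z) <= \dim (EndS Z'))%N.

Definition generic_extension (K : fieldType) (Y X Z : triple K) : Prop :=
  minimal_extension Y X Z /\
  forall Z', minimal_extension Y X Z' -> iso Z' Z.

(* Direct sums of triples, with N_l (+) N_l' identified with N_(l ++ l'). *)
Fixpoint kmod_cat (K : fieldType) (l l' : seq nat) :
    kmod K l -> kmod K l' -> kmod K (l ++ l') :=
  match l return kmod K l -> kmod K l' -> kmod K (l ++ l') with
  | [::] => fun _ y => y
  | _ :: _ => fun x y => (x.1, kmod_cat x.2 y)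
  end.

Fixpoint kmod_split (K : fieldType) (l l' : seq nat) :
    kmod K (l ++ l') -> (kmod K l * kmod K l')%type :=
  match l return kmod K (l ++ l') -> (kmod K l * kmod K l')%type with
  | [::] => fun z => (0, z)
  | _ :: _ => fun z => let s := kmod_split z.2 in ((z.1, s.1), s.2)
  end.

Section DirectSum.

Variable K : fieldType.

Lemma kmod_catK l l' (x : kmod K l) (y : kmod K l') :
  kmod_split (kmod_cat x y) = (x, y).
Proof.
elim: l x => [|m l IH] x /=; last by rewrite IH; case: x.
by congr pair; apply/rowP; case.
Qed.

Lemma kmod_splitK l l' (z : kmod K (l ++ l')) :
  kmod_cat (kmod_split z).1 (kmod_split z).2 = z.
Proof. by elim: l z => [//|m l IH] z /=; rewrite IH; case: z. Qed.

Lemma kmod_cat_linear l l' c (x x' : kmod K l) (y y' : kmod K l') :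
  kmod_cat (c *: x + x') (c *: y + y') = c *: kmod_cat x y + kmod_cat x' y'.
Proof. by elim: l x x' => [//|m l IH] x x' /=; rewrite IH. Qed.

Section Fix_XY.

Variables X Y : triple K.

Definition dsum_emb (z : kmod K (al X ++ al Y)) : kmod K (be X ++ be Y) :=
  let s := kmod_split z in kmod_cat (emb X s.1) (emb Y s.2).

Lemma dsum_emb_linear : linear dsum_emb.
Proof.
move=> c z z'; rewrite -[z]kmod_splitK -[z']kmod_splitK.
rewrite -kmod_cat_linear /dsum_emb !kmod_catK /=.
by rewrite !linearP kmod_cat_linear.
Qed.

HB.instance Definition _ :=
  GRing.isLinear.Build K (kmod K (al X ++ al Y)) (kmod K (be X ++ be Y)) *:%R
    dsum_emb dsum_emb_linear.

Definition dsum : triple K :=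
  Triple (al X ++ al Y) (be X ++ be Y) (linfun dsum_emb).

Lemma dsumE x y : emb dsum (kmod_cat x y) = kmod_cat (emb X x) (emb Y y).
Proof. by rewrite lfunE /= /dsum_emb kmod_catK. Qed.

End Fix_XY.

Definition zero_triple : triple K := Triple [::] [::] 0.

Definition P0 (m : nat) : triple K := Triple [::] [:: m] 0.

(* The K[T]-homomorphism N_(1) -> N_(m) mapping 1 to T^(m-1). An element of
   N_(1) is represented by a constant polynomial. *)
Definition P1_emb (m : nat) (x : kmod K [:: 1%N]) : kmod K [:: m] :=
  (in_qpoly 'X^m ('X^(m.-1) * (x.1 : {poly K})), 0).

Lemma P1_emb_linear m : linear (@P1_emb m).
Proof.
move=> c x y; rewrite /P1_emb /= mulrDr -scalerAr in_qpolyD in_qpolyZ.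
by congr pair; apply/rowP; case.
Qed.

HB.instance Definition _ (m : nat) :=
  GRing.isLinear.Build K (kmod K [:: 1%N]) (kmod K [:: m]) *:%R
    (@P1_emb m) (@P1_emb_linear m).

Definition P1 (m : nat) : triple K := Triple [:: 1%N] [:: m] (linfun (@P1_emb m)).

Definition Pind (eps m : nat) : triple K :=
  if eps == 0%N then P0 m else P1 m.

(* The object of S_1 given by (g, b). *)
Definition obj (g b : seq nat) : triple K :=
  foldr dsum zero_triple
    [seq Pind (nth 0 b i - nth 0 g i) (nth 0 b i) | i <- iota 0 (size b)]%N.

End DirectSum.

(* X is (up to isomorphism) the object given by (g, b). *)
Definition given_by (K : fieldType) (X : triple K) (g b : seq nat) : Prop :=
  S1_pair g b /\ iso X (obj K g b).

(* Main.v *)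
From HB Require Import structures.
Require Import Defs.
From mathcomp Require Import all_boot all_algebra zify.

Set Implicit Arguments.
Unset Strict Implicit.
Unset Printing Implicit Defensive.

Import GRing.Theory.
Local Open Scope ring_scope.

(** Why the theorem holds.

    An object of S_1 amounts to a nilpotent operator on a finite-dimensional
    space together with a subspace of its kernel, the image of the embedding,
    called the mark here. Such a pair is a direct sum of Jordan blocks in which
    the socle of each block is either marked or not ([decompose]). So objects
    are lists of pairs (is the block marked, size of the block). Up to
    isomorphism an object is determined by the numbers dim ker T^n and
    dim (T^n)^-1 (mark), that is, by the functions n |-> sum_i min(n, beta_i)
    and n |-> sum_i min(n, gamma_i) ([miso_of_dims]).

    These numbers are also the dimensions of Hom(P, Z) for P indecomposable, so
    dim End Z decreases when both functions decrease. If dim End Z does not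
    change, the two functions agree at all block sizes, hence everywhere
    because they are concave ([hdim_min], [hdim_min_eq]). For partitions of a
    fixed number, sum_i min(n, beta_i) is small when the sums of the k largest
    parts are large. It thus remains to show that Y * X has the largest
    partial sums of beta and of gamma among all extensions.

    Upper bounds: the sum of the k largest parts of a module is the dimension
    of a submodule with k generators, and a submodule V with k generators is
    cut by any submodule B into two pieces with k generators, one in B and one
    in the quotient by B ([filtration_bound]). Let Z be an extension of Y by X,
    with mark U, and let a be the dimension of the mark of Y ([mext_bounds]).
    - With B the image of X in Z / U: gamma^Z is at most gamma^X + gamma^Y.
    - With B = X in Z: beta^Z is at most beta^X + beta^Y.
    - With B = X + U in Z: the quotient is Y modulo its mark, and B is X plus
      a blocks of size 1, since U is killed by T. So beta^Z is at most gamma^Y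
      plus the partition formed by beta^X and a parts equal to 1.
    With p the number of parts of beta^X, the last two bounds together say that
    the sum of the k largest parts of beta^Z exceeds that of
    beta^X + gamma^Y by at most min(k - p, number of marks among the first k
    blocks of Y), where k - p is replaced by 0 when k < p. The algorithm reaches
    this value: it is a queue which receives the marked blocks of Y and, from
    position p on, serves one of them per position ([top_betas_star]).

    The object computed by the algorithm is an extension ([mext_star]): it is a
    direct sum of extensions of two kinds, concatenation of a block of X with
    an unmarked block of Y ([mext_concat]), and concatenation with a marked
    block whose mark moves to a shorter unmarked block, possibly of size 0
    ([mext_exchange]). *)

(** * Linear algebra *)

Section LinearAlgebra.

Variable K : fieldType.

Lemma lfun_of_linear (A B : vectType K) (f : A -> B) :
  linear f -> {h : 'Hom(A, B) | h =1 f}.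
Proof.
move=> lf.
pose f' : {linear A -> B} := HB.pack f (GRing.isLinear.Build K A B *:%R f lf).
by exists (linfun f') => x; apply: (lfunE f').
Qed.

Lemma dimv_bij (A B : vectType K) (f : 'Hom(A, B)) (U : {vspace A})
    (W : {vspace B}) :
    (forall x, x \in U -> f x \in W) ->
    (forall x, x \in U -> f x = 0 -> x = 0) ->
    (forall y, y \in W -> exists2 x, x \in U & f x = y) ->
  \dim U = \dim W.
Proof.
move=> fUW f_inj f_surj; have -> : W = (f @: U)%VS.
  apply/vspaceP=> y; apply/idP/memv_imgP => [/f_surj[x Ux <-]|[x Ux ->]].
    by exists x.
  exact: fUW.
rewrite limg_dim_eq //; apply/eqP; rewrite -subv0; apply/subvP=> x.
by rewrite memv_cap memv_ker memv0 => /andP[Ux /eqP/(f_inj x Ux)/eqP].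
Qed.

Lemma dimv_inj (A B : vectType K) (f : 'Hom(A, B)) (U : {vspace A}) :
  injective f -> \dim (f @: U) = \dim U.
Proof. by move=> /lker0P/eqP kf; rewrite limg_dim_eq // kf capv0. Qed.

Definition prodv (A B : vectType K) (U : {vspace A}) (W : {vspace B}) :
    {vspace (A * B)%type} :=
  ((linfun (@fst A B) @^-1: U) :&: (linfun (@snd A B) @^-1: W))%VS.

Lemma mem_prodv (A B : vectType K) (U : {vspace A}) (W : {vspace B}) z :
  (z \in prodv U W) = (z.1 \in U) && (z.2 \in W).
Proof. by rewrite memv_cap -!memv_preim !lfunE. Qed.

Lemma inl_linear (A B : vectType K) : linear (fun x : A => (x, 0 : B)).
Proof. by move=> a x y; congr pair; rewrite /= ?scaler0 ?addr0. Qed.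

Lemma inr_linear (A B : vectType K) : linear (fun y : B => (0 : A, y)).
Proof. by move=> a x y; congr pair; rewrite /= ?scaler0 ?addr0. Qed.

Definition inlv (A B : vectType K) : 'Hom(A, (A * B)%type) :=
  sval (lfun_of_linear (@inl_linear A B)).
Definition inrv (A B : vectType K) : 'Hom(B, (A * B)%type) :=
  sval (lfun_of_linear (@inr_linear A B)).

Lemma inlvE (A B : vectType K) x : inlv A B x = (x, 0).
Proof. exact: (svalP (lfun_of_linear (@inl_linear A B))). Qed.

Lemma inrvE (A B : vectType K) y : inrv A B y = (0, y).
Proof. exact: (svalP (lfun_of_linear (@inr_linear A B))). Qed.

Lemma dim_prodv (A B : vectType K) (U : {vspace A}) (W : {vspace B}) :
  \dim (prodv U W) = (\dim U + \dim W)%N.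
Proof.
rewrite -(limg_ker_dim (linfun (@snd A B)) (prodv U W)); congr addn.
  symmetry; apply: (@dimv_bij _ _ (inlv A B)) => [x Ux|x _|[x y]].
  - by rewrite memv_cap mem_prodv memv_ker lfunE inlvE /= Ux mem0v eqxx.
  - by rewrite inlvE => -[].
  - rewrite memv_cap mem_prodv memv_ker lfunE /= => /andP[/andP[Ux _] /eqP->].
    by exists x; rewrite ?inlvE.
congr (\dim _); apply/vspaceP=> y; apply/memv_imgP/idP => [[z]|Wy].
  by rewrite mem_prodv lfunE => /andP[_ Wz] ->.
by exists (0, y); rewrite ?lfunE // mem_prodv mem0v.
Qed.

Lemma pair_lfun (A B C : vectType K) (f : 'Hom(A, C)) (g : 'Hom(B, C)) :
  {h : 'Hom((A * B)%type, C) | forall z, h z = f z.1 + g z.2}.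
Proof.
apply: lfun_of_linear => a x y /=.
by rewrite !linearP /= scalerDr addrACA.
Qed.

Lemma prod_lfun (A B C D : vectType K) (f : 'Hom(A, C)) (g : 'Hom(B, D)) :
  {h : 'Hom((A * B)%type, (C * D)%type) | forall z, h z = (f z.1, g z.2)}.
Proof. by apply: lfun_of_linear => a x y /=; rewrite !linearP. Qed.

Lemma prod_lfun1 (A C D : vectType K) (f : 'Hom(A, C)) (g : 'Hom(A, D)) :
  {h : 'Hom(A, (C * D)%type) | forall z, h z = (f z, g z)}.
Proof. by apply: lfun_of_linear => a x y /=; rewrite !linearP. Qed.

End LinearAlgebra.

(** * Operators with a marked subspace *)

(** An object of S_1 becomes such a structure when its embedding is replaced by
    the image of the embedding, see [marked_of]; its endomorphisms stay the
    same, see [dim_EndS]. *)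
Record marked (K : fieldType) := Marked {
  space :> vectType K;
  shift : 'End(space);
  mark : {vspace space}
}.
Arguments shift {K} m : simpl never.
Arguments mark {K} m : simpl never.
Arguments space {K} m : simpl never.

Section Marked.

Variable K : fieldType.
Implicit Types M N : marked K.

Fixpoint shiftn M n : 'End(M) :=
  if n is n'.+1 then (shift M \o shiftn M n')%VF else \1%VF.

Arguments shiftn : simpl never.

Lemma shiftnE M n x : shiftn M n x = iter n (shift M) x.
Proof. by elim: n => [|n IH]; rewrite /= ?id_lfunE // comp_lfunE -IH. Qed.

Lemma shiftnD M m n x : shiftn M (m + n) x = shiftn M m (shiftn M n x).
Proof. by rewrite !shiftnE iterD. Qed.

Lemma shiftnS M n x : shiftn M n.+1 x = shiftn M n (shift M x).
Proof. by rewrite !shiftnE iterSr. Qed.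

Lemma shiftSn M n x : shiftn M n.+1 x = shift M (shiftn M n x).
Proof. exact: comp_lfunE. Qed.

Lemma shiftn0 M x : shiftn M 0 x = x.
Proof. exact: id_lfunE. Qed.

Lemma shiftn_eq0 M m n x : (m <= n)%N -> shiftn M m x = 0 -> shiftn M n x = 0.
Proof. by move=> /subnK<- Tx; rewrite shiftnD Tx linear0. Qed.

Definition equivariant M N (f : 'Hom(M, N)) :=
  forall x, f (shift M x) = shift N (f x).

Lemma equivariantn M N (f : 'Hom(M, N)) n x :
  equivariant f -> f (shiftn M n x) = shiftn N n (f x).
Proof.
by move=> ef; elim: n => [|n IH]; rewrite ?shiftn0 // !shiftSn ef IH.
Qed.

(** The marked operators that come from S_1. *)
Definition regular M :=
  (exists n, forall x, shiftn M n x = 0) /\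
  (forall u, u \in mark M -> shift M u = 0).

Definition miso M N := exists (h : 'Hom(M, N)) (k : 'Hom(N, M)),
  [/\ equivariant h, cancel h k, cancel k h,
      forall x, x \in mark M -> h x \in mark N &
      forall y, y \in mark N -> k y \in mark M].

Lemma miso_inv_equivariant M N (h : 'Hom(M, N)) (k : 'Hom(N, M)) :
  equivariant h -> cancel h k -> cancel k h -> equivariant k.
Proof. by move=> eh hK kK x; apply: (can_inj hK); rewrite eh !kK. Qed.

Lemma miso_refl M : miso M M.
Proof. by exists \1%VF, \1%VF; split=> x; rewrite ?id_lfunE. Qed.

Lemma miso_sym M N : miso M N -> miso N M.
Proof.
move=> [h [k [eh hK kK hU kU]]]; exists k, h; split=> //.
exact: miso_inv_equivariant eh hK kK.
Qed.

Lemma miso_trans M N P : miso M N -> miso N P -> miso M P.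
Proof.
move=> [h [k [eh hK kK hU kU]]] [h' [k' [eh' hK' kK' hU' kU']]].
exists (h' \o h)%VF, (k \o k')%VF; split=> x; rewrite ?comp_lfunE.
- by rewrite eh eh'.
- by rewrite hK' hK.
- by rewrite kK kK'.
- by move=> /hU/hU'.
- by move=> /kU'/kU.
Qed.

Lemma misoI M N (h : 'Hom(M, N)) :
    equivariant h -> injective h -> (forall y, exists x, h x = y) ->
    (forall x, (h x \in mark N) = (x \in mark M)) ->
  miso M N.
Proof.
move=> eh /lker0P h_inj h_surj hU.
have hK : cancel h (h^-1)%VF by apply: lker0_lfunK.
have kK : cancel (h^-1)%VF h.
  by move=> y; have [x <-] := h_surj y; rewrite hK.
exists h, (h^-1)%VF; split=> // [x|y]; rewrite -hU //.
by rewrite kK.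
Qed.

Definition mzero : marked K := Marked (0 : 'End('rV[K]_0)) 0.

Lemma mzero0 (x : mzero) : x = 0.
Proof. by apply/rowP; case. Qed.

Definition msum M N : marked K :=
  Marked (sval (prod_lfun (shift M) (shift N))) (prodv (mark M) (mark N)).

Lemma shift_msum M N z : shift (msum M N) z = (shift M z.1, shift N z.2).
Proof. exact: (svalP (prod_lfun (shift M) (shift N)) z). Qed.

Lemma shiftn_msum M N n z :
  shiftn (msum M N) n z = (shiftn M n z.1, shiftn N n z.2).
Proof.
elim: n => [|n IH]; first by rewrite !shiftn0; case: z.
by rewrite !shiftSn IH shift_msum.
Qed.

Lemma mem_mark_msum M N z :
  (z \in mark (msum M N)) = (z.1 \in mark M) && (z.2 \in mark N).
Proof. exact: mem_prodv. Qed.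

Lemma regular_mzero : regular mzero.
Proof. by split=> [|u _]; [exists 0%N => x|]; apply: mzero0. Qed.

Lemma regular_msum M N : regular M -> regular N -> regular (msum M N).
Proof.
move=> [[m Tm] UM] [[n Tn] UN]; split.
  exists (m + n)%N => -[x y]; rewrite shiftn_msum /=; congr pair.
    by apply: (shiftn_eq0 (leq_addr n m)).
  by apply: (shiftn_eq0 (leq_addl m n)).
by move=> [x y]; rewrite mem_mark_msum shift_msum => /andP[/= /UM-> /UN->].
Qed.

Lemma miso_msum M M' N N' :
  miso M M' -> miso N N' -> miso (msum M N) (msum M' N').
Proof.
move=> [h [k [eh hK kK hU kU]]] [h' [k' [eh' hK' kK' hU' kU']]].
have [H HE] := prod_lfun h h'; have [L LE] := prod_lfun k k'.
exists H, L; split=> z.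
- by rewrite !(HE, shift_msum) /= eh eh'.
- by rewrite HE LE /= hK hK'; case: z.
- by rewrite HE LE /= kK kK'; case: z.
- by rewrite !mem_mark_msum HE => /andP[/= /hU-> /hU'->].
- by rewrite !mem_mark_msum LE => /andP[/= /kU-> /kU'->].
Qed.

(** In the classification these two sequences are read as
    sum_i min(n, beta_i) and dim mark + sum_i min(n, gamma_i). *)
Definition kdim M n := \dim (lker (shiftn M n)).
Definition mdim M n := \dim (shiftn M n @^-1: mark M)%VS.

Lemma kdim_msum M N n : kdim (msum M N) n = (kdim M n + kdim N n)%N.
Proof.
rewrite /kdim -dim_prodv; congr (\dim _); apply/vspaceP=> z.
by rewrite mem_prodv !memv_ker shiftn_msum.
Qed.

Lemma mdim_msum M N n : mdim (msum M N) n = (mdim M n + mdim N n)%N.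
Proof.
rewrite /mdim -dim_prodv; congr (\dim _); apply/vspaceP=> z.
by rewrite mem_prodv -!memv_preim shiftn_msum mem_mark_msum.
Qed.

Lemma kdim_miso M N n : miso M N -> kdim M n = kdim N n.
Proof.
move=> [h [k [eh hK kK _ _]]].
have ek := miso_inv_equivariant eh hK kK.
apply: (@dimv_bij _ _ _ h) => [x|x _ hx0|y]; rewrite ?memv_ker.
- by rewrite -(equivariantn _ _ eh) => /eqP->; rewrite linear0.
- by rewrite -[x]hK hx0 linear0.
- move=> /eqP Ty; exists (k y); rewrite ?kK //.
  by rewrite memv_ker -(equivariantn _ _ ek) Ty linear0.
Qed.

Lemma mdim_miso M N n : miso M N -> mdim M n = mdim N n.
Proof.
move=> [h [k [eh hK kK hU kU]]].
have ek := miso_inv_equivariant eh hK kK.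
apply: (@dimv_bij _ _ _ h) => [x|x _ hx0|y]; rewrite -?memv_preim.
- by rewrite -(equivariantn _ _ eh) => /hU.
- by rewrite -[x]hK hx0 linear0.
- move=> Ty; exists (k y); rewrite ?kK //.
  by rewrite -memv_preim -(equivariantn _ _ ek) kU.
Qed.

Lemma kdim_mzero n : kdim mzero n = 0%N.
Proof.
apply/eqP; rewrite dimv_eq0 -subv0; apply/subvP=> x _.
by rewrite (mzero0 x) mem0v.
Qed.

Lemma mdim_mzero n : mdim mzero n = 0%N.
Proof.
apply/eqP; rewrite dimv_eq0 -subv0; apply/subvP=> x _.
by rewrite (mzero0 x) mem0v.
Qed.

End Marked.

Arguments shiftn : simpl never.

(** * Jordan blocks *)

Section Cyclic.

Variable K : fieldType.
Implicit Types (e : bool * nat) (m n : nat).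

Lemma cyc_shift_linear m :
  linear (fun x : {poly_m K} => npolyp m ('X * (x : {poly K}))).
Proof.
move=> a x y; apply/npolyP=> i.
have -> : ((a *: x + y : {poly_m K}) : {poly K}) = a *: (x : {poly K}) + y.
  by [].
rewrite coef_npolyp mulrDr -scalerAr.
rewrite [RHS](_ : _ = a * (npolyp m ('X * (x : {poly K})))`_i
  + (npolyp m ('X * (y : {poly K})))`_i); last by rewrite /= coefD coefZ.
by rewrite coefD coefZ !coef_npolyp; case: ifP => // _; rewrite mulr0 addr0.
Qed.

Definition cyc_shift m : 'End({poly_m K}) :=
  sval (lfun_of_linear (@cyc_shift_linear m)).

(** The polynomials of degree less than the size [e.2], with truncated
    multiplication by the variable; the socle is marked when [e.1] holds. This
    model makes sense for size 0 as well, and then it is the zero module. *)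
Definition cyc e : marked K :=
  @Marked K {poly_(e.2) K} (cyc_shift e.2)
    (if e.1 then lker (cyc_shift e.2) else 0%VS).

Definition gen e : cyc e := npolyp e.2 1.

Lemma coef_shift e (x : cyc e) i :
  (shift (cyc e) x)`_i = if (0 < i < e.2)%N then x`_i.-1 else 0.
Proof.
rewrite /= /cyc_shift (svalP (lfun_of_linear (@cyc_shift_linear e.2))).
by rewrite coef_npolyp coefXM; case: i => [|i] /=; case: ifP.
Qed.

Lemma coef_shiftn e (x : cyc e) n i :
  (shiftn (cyc e) n x)`_i = if (n <= i < e.2)%N then x`_(i - n) else 0.
Proof.
elim: n i => [|n IH] i.
  by rewrite shiftn0 subn0 /=; case: ltnP => // /big_coef_npoly->.
rewrite shiftSn coef_shift IH; case: i => [|i] //=.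
rewrite subSS ltnS; case: (ltnP i.+1 e.2) => [lim|]; rewrite ?andbF //.
by rewrite (ltnW lim).
Qed.

Lemma coef_gen e n i :
  (shiftn (cyc e) n (gen e))`_i = ((n == i) && (i < e.2)%N)%:R.
Proof.
rewrite coef_shiftn coef_npolyp coef1 subn_eq0 eqn_leq.
case: (ltnP i e.2) => i_lt; rewrite ?andbF ?andbT //.
by rewrite (leq_ltn_trans (leq_subr _ _) i_lt); case: (n <= i)%N.
Qed.

Lemma gen_order e : shiftn (cyc e) e.2 (gen e) = 0.
Proof.
apply/npolyP=> i; rewrite coef_gen coef0.
by case: eqP => //= <-; rewrite ltnn.
Qed.

Lemma cyc_order e (x : cyc e) : shiftn (cyc e) e.2 x = 0.
Proof.
by apply/npolyP=> i; rewrite coef_shiftn coef0; case: leqP => // /ltnW; case: leqP.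
Qed.

(** Shifting up the lowest coefficient of [x] until it becomes the top one
    kills all the others. *)
Lemma cyc_socle e (x : cyc e) : x != 0 ->
  exists k c, c != 0 /\ shiftn (cyc e) k x = c *: shiftn (cyc e) e.2.-1 (gen e).
Proof.
move=> xn0; have [i xi] : exists i, x`_i != 0.
  have : (x : {poly K}) != 0 by apply: contraNneq xn0 => x0; apply/eqP/val_inj.
  by rewrite -lead_coef_eq0 => ?; exists (size x).-1.
pose j := ex_minn (ex_intro (fun i => x`_i != 0) i xi).
have [xj jmin] : x`_j != 0 /\ forall i, x`_i != 0 -> (j <= i)%N.
  by rewrite /j; case: ex_minnP.
have j_lt : (j < e.2)%N.
  by rewrite ltnNge; apply: contraNN xj => /big_coef_npoly->.
exists (e.2.-1 - j)%N, x`_j; split=> //; apply/npolyP=> l.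
rewrite coef_shiftn [RHS]coefZ coef_gen.
case: ifP => [/andP[jl l_lt]|].
  case: (eqVneq e.2.-1 l) => [<-|nl]; last first.
    have lj : (l - (e.2.-1 - j) < j)%N by lia.
    rewrite mulr0; apply/eqP/negP => /negP/jmin; lia.
  rewrite ltn_predL (leq_ltn_trans _ j_lt) // mulr1; congr (_`_ _); lia.
move=> lF; case: eqP => [le|]; last by rewrite mulr0.
case: ltnP => [l_lt|]; rewrite ?mulr0 //; move: lF; lia.
Qed.

Lemma cyc_ker e (x : cyc e) :
  shift (cyc e) x = 0 -> exists c, x = c *: shiftn (cyc e) e.2.-1 (gen e).
Proof.
move=> Tx; case: (eqVneq x 0) => [->|/cyc_socle[[|k] [c [cn0]]]].
- by exists 0; rewrite scale0r.
- by rewrite shiftn0 => ->; exists c.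
- rewrite shiftnS Tx linear0 => /esym/eqP; rewrite scaler_eq0 (negPf cn0) /=.
  move=> /eqP gen0; exists 0; rewrite scale0r; apply/npolyP=> i.
  have e20 : e.2 = 0%N.
    have /npolyP/(_ e.2.-1) := gen0; rewrite coef_gen coef0 eqxx ltn_predL.
    by case: (e.2) => //= n /eqP; rewrite oner_eq0.
  by rewrite coef0 big_coef_npoly // e20.
Qed.

Lemma gen_socle_neq0 e : (0 < e.2)%N -> shiftn (cyc e) e.2.-1 (gen e) != 0.
Proof.
move=> m_gt0; apply/eqP=> /npolyP/(_ e.2.-1)/eqP.
by rewrite coef_gen coef0 eqxx ltn_predL m_gt0 oner_eq0.
Qed.

Lemma mem_mark_cyc e (x : cyc e) :
  (x \in mark (cyc e)) = (x == 0) || e.1 && (shift (cyc e) x == 0).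
Proof.
rewrite /mark /=; case: e.1 => /=; last by rewrite memv0 orbF.
rewrite memv_ker; case: (eqVneq x 0) => [->|] //=.
by rewrite linear0 eqxx.
Qed.

Lemma regular_cyc e : regular (cyc e).
Proof.
split; first by exists e.2; apply: cyc_order.
move=> u; rewrite mem_mark_cyc => /orP[/eqP->|/andP[_ /eqP//]].
exact: linear0.
Qed.

Lemma gen_expand e (x : cyc e) :
  x = \sum_(i < e.2) x`_i *: shiftn (cyc e) i (gen e).
Proof.
apply/npolyP=> j; rewrite coefn_sum.
case: (ltnP j e.2) => [j_lt|j_ge]; last first.
  rewrite big_coef_npoly // big1 // => i _.
  by rewrite [LHS]coefZ coef_gen ltnNge j_ge andbF mulr0.
rewrite (bigD1 (Ordinal j_lt)) //= [X in X + _]coefZ coef_gen eqxx j_lt mulr1.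
rewrite big1 ?addr0 // => i /eqP ij; rewrite [LHS]coefZ coef_gen.
case: eqP => [eij|]; last by rewrite mulr0.
by case: ij; apply: val_inj.
Qed.

(** The universal property of a block: it is generated by [gen e], with
    [gen_order] as the only relation. *)
Lemma cyc_hom e (M : marked K) (y : M) : shiftn M e.2 y = 0 ->
  {f : 'Hom(cyc e, M) | equivariant f /\ f (gen e) = y}.
Proof.
move=> Ty.
pose f0 (x : cyc e) := \sum_(i < e.2) x`_i *: shiftn M i y.
have f0_lin : linear f0.
  move=> a u v; rewrite /f0 scaler_sumr -big_split; apply: eq_bigr => i _ /=.
  by rewrite coefD coefZ scalerDl scalerA.
have [f fE] := lfun_of_linear f0_lin; exists f; split.
  move=> x; rewrite !fE /f0; under eq_bigr => i _ do rewrite coef_shift.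
  have shift_sum (c : nat -> K) m : shiftn M m y = 0 ->
      \sum_(i < m) (if (0 < i < m)%N then c i.-1 else 0) *: shiftn M i y
      = shift M (\sum_(i < m) c i *: shiftn M i y).
    case: m => [|m] Tmy; first by rewrite !big_ord0 linear0.
    rewrite big_ord_recl big_ord_recr /= scale0r add0r linearD linearZ /=.
    rewrite -shiftSn Tmy scaler0 addr0 linear_sum; apply: eq_bigr => i _.
    by rewrite linearZ /= shiftSn ltnS ltn_ord.
  exact: shift_sum.
rewrite fE /f0; under eq_bigr => i _ do rewrite -[gen e]shiftn0 coef_gen.
case: (e.2) Ty => [|m] Ty; first by rewrite big_ord0 -Ty shiftn0.
by rewrite big_ord_recl big1 ?addr0 ?scale1r ?shiftn0 // => i _; rewrite scale0r.
Qed.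

Lemma cyc_hom_eq0 e (M : marked K) (f : 'Hom(cyc e, M)) :
  equivariant f -> f (gen e) = 0 -> f = 0.
Proof.
move=> ef fg; apply/lfunP=> x; rewrite zero_lfunE (gen_expand x) linear_sum.
by apply: big1 => i _; rewrite linearZ /= (equivariantn _ _ ef) fg !linear0.
Qed.

(** A kernel that is not zero would contain the socle, by [cyc_socle]. *)
Lemma cyc_hom_inj e (M : marked K) (f : 'Hom(cyc e, M)) :
  equivariant f -> (0 < e.2)%N -> shiftn M e.2.-1 (f (gen e)) != 0 ->
  injective f.
Proof.
move=> ef m_gt0 fn0; apply/lker0P; rewrite -subv0; apply/subvP=> x.
rewrite memv_ker memv0 => /eqP fx; apply: contraNT fn0 => /cyc_socle.
move=> [k [c [cn0 Tx]]]; rewrite -(equivariantn _ _ ef).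
rewrite -[X in f X](scalerK cn0) -Tx linearZ /= (equivariantn _ _ ef) fx.
by rewrite linear0 scaler0.
Qed.

Lemma dim_cyc e : \dim {: cyc e} = e.2.
Proof. exact: dim_polyn. Qed.

(** The kernel of the shift is a line, so [kdim] grows by at most one at each
    step; from 0 to [e.2] in [e.2] steps, it has to grow by one each time. *)
Lemma kdim_cyc e n : kdim (cyc e) n = minn n e.2.
Proof.
have step k : (kdim (cyc e) k.+1 <= (kdim (cyc e) k).+1)%N.
  rewrite -[(kdim _ k).+1]addn1 -[kdim _ k.+1]/(\dim (lker (shiftn (cyc e) k.+1))).
  rewrite -(limg_ker_dim (shiftn (cyc e) k) (lker (shiftn (cyc e) k.+1))).
  apply: leq_add; first by apply: dimvS; apply: capvSr.
  apply: leq_trans (_ : \dim <[shiftn (cyc e) e.2.-1 (gen e)]> <= _)%N; last first.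
    by rewrite dim_vline leq_b1.
  apply: dimvS; apply/subvP=> _ /memv_imgP[x + ->].
  rewrite memv_ker shiftSn => /eqP/cyc_ker[c ->].
  by rewrite memvZ ?memv_line.
have k0 : kdim (cyc e) 0 = 0%N.
  apply/eqP; rewrite dimv_eq0 -subv0; apply/subvP=> x.
  by rewrite memv_ker memv0 shiftn0.
have kge k : (e.2 <= k)%N -> kdim (cyc e) k = e.2.
  move=> le_k; rewrite -[RHS]dim_cyc; congr (\dim _).
  apply/vspaceP=> x; rewrite memvf memv_ker.
  by rewrite (shiftn_eq0 le_k (cyc_order x)) eqxx.
have up k j : (kdim (cyc e) (k + j) <= kdim (cyc e) k + j)%N.
  elim: j => [|j IH]; rewrite ?addn0 // !addnS.
  by rewrite (leq_trans (step _)) ?ltnS.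
case: (leqP e.2 n) => [/[dup] /kge-> /minn_idPr//|n_lt].
have := up n (e.2 - n)%N; have := up 0%N n.
rewrite add0n k0 subnKC ?(ltnW n_lt) // (kge e.2) //; lia.
Qed.

Lemma mdim_cyc e n :
  (e.1 <= e.2)%N -> mdim (cyc e) n = (e.1 + minn n (e.2 - e.1))%N.
Proof.
move=> e_ok; rewrite -[mdim _ _]/(\dim _).
have -> : (shiftn (cyc e) n @^-1: mark (cyc e))%VS
    = lker (shiftn (cyc e) (e.1 + n)).
  apply/vspaceP=> x; rewrite -memv_preim memv_ker mem_mark_cyc.
  (* A marked socle is the kernel of the shift, whence one more iteration. *)
  case: e.1 => /=; last by rewrite orbF.
  rewrite -[X in _ || X]/(shift (cyc e) _ == 0) -shiftSn.
  by apply/orb_idl=> /eqP Tx; rewrite (@shiftn_eq0 _ (cyc e) _ _ _ (leqnSn n) Tx).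
rewrite -[\dim _]/(kdim _ _) kdim_cyc; move: e_ok; lia.
Qed.

End Cyclic.

(** * Decomposition into Jordan blocks *)

Section Decomposition.

Variable K : fieldType.
Implicit Types (e : bool * nat) (s : seq (bool * nat)) (M : marked K).

Fixpoint Nsum s : marked K :=
  if s is e :: s' then msum (cyc K e) (Nsum s') else mzero K.

Lemma regular_Nsum s : regular (Nsum s).
Proof.
elim: s => [|e s IH]; first exact: regular_mzero.
by apply: regular_msum IH; apply: regular_cyc.
Qed.

Lemma kdim_Nsum s n : kdim (Nsum s) n = (\sum_(e <- s) minn n e.2)%N.
Proof.
elim: s => [|e s IH]; first by rewrite big_nil kdim_mzero.
by rewrite big_cons kdim_msum kdim_cyc IH.
Qed.

Lemma mdim_Nsum s n : all (fun e => e.1 <= e.2)%N s ->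
  mdim (Nsum s) n = (\sum_(e <- s) (e.1 + minn n (e.2 - e.1)))%N.
Proof.
elim: s => [|e s IH] /=; first by rewrite big_nil mdim_mzero.
by case/andP=> e_ok /IH; rewrite big_cons mdim_msum mdim_cyc // => ->.
Qed.

(** Both the sizes [e.2] (parts of beta) and the numbers [e.2 - e.1] (parts of
    gamma) decrease along a standard list; among blocks of equal size the
    unmarked ones come first. *)
Definition dominates e e' := (e'.2 <= e.2)%N && (e'.2 - e'.1 <= e.2 - e.1)%N.

Definition standard s := sorted dominates s && all (fun e => 0 < e.2)%N s.

Lemma separating_form (V : vectType K) (W : {vspace V}) (v : V) : v \notin W ->
  exists phi : 'Hom(V, K^o), phi v = 1 /\ forall w, w \in W -> phi w = 0.
Proof.
move=> vW; pose pi := (\1 - projv W)%VF.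
have piE x : pi x = x - projv W x by rewrite add_lfunE opp_lfunE id_lfunE.
have piv : pi v != 0.
  by rewrite piE subr_eq0; apply: contraNneq vW => ->; rewrite memv_proj.
pose X := [tuple pi v].
have f_lin : linear (fun x : V => coord X ord0 (pi x) : K^o).
  by move=> a x y; rewrite !linearP.
have [phi phiE] := lfun_of_linear f_lin; exists phi; split=> [|w Ww].
  rewrite phiE -[pi v]/(X`_(@ord0 0)) coord_free ?eqxx //.
  by rewrite seq1_free.
by rewrite phiE piE projv_id // subrr linear0.
Qed.

(** The generator of the block to be split off from [C]: its size is the
    nilpotency order of the operator on [C], and its socle is left unmarked
    whenever possible, which is what makes the resulting list standard. *)
Lemma top_vector M (C : {vspace M}) : regular M -> C != 0%VS ->
  exists n x, [/\ x \in C, shiftn M n x != 0,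
    forall y, y \in C -> shiftn M n.+1 y = 0 &
    shiftn M n x \in mark M -> forall y, y \in C -> shiftn M n y \in mark M].
Proof.
move=> [[N TN] _] Cn0.
pose P k := (shiftn M k @: C == 0)%VS.
have PN : P N.
  by rewrite /P -lkerE; apply/subvP=> x _; rewrite memv_ker TN.
have [n Pn nmin] := ex_minnP (ex_intro P N PN).
case: n Pn nmin => [|n] Pn nmin; first by case/eqP: Cn0; rewrite -(eqP Pn) lim1g.
have T0 y : y \in C -> shiftn M n.+1 y = 0.
  by move=> Cy; apply/eqP; rewrite -memv0 -(eqP Pn) memv_img.
exists n; have [sub|/subvPn[_ /memv_imgP[x Cx ->] Tx]] :=
  boolP (shiftn M n @: C <= mark M)%VS; last first.
  exists x; split=> //; last by rewrite (negPf Tx).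
  by apply: contraNneq Tx => ->; rewrite mem0v.
have /subvPn[_ /memv_imgP[x Cx ->]] : ~~ (shiftn M n @: C <= 0)%VS.
  by rewrite subv0; apply/negP => /nmin; rewrite ltnn.
rewrite memv0 => Tx; exists x; split=> // _ y Cy.
by apply: (subvP sub); apply: memv_img.
Qed.

(** Let [x] generate a block of maximal size in [C], with socle [sx], and let
    [phi] be a linear form with [phi sx = 1] that vanishes on the mark unless
    [sx] is marked. The vectors of [C] at which [phi] vanishes along their whole
    orbit form a stable complement [C'] of the block: the block meets it
    trivially because any nonzero submodule of the block contains [sx], and it
    is cut out by as many equations as the block has dimensions. The mark is
    compatible with this splitting by the choice of [phi]. *)
Lemma decompose_sub M : regular M -> forall C : {vspace M},
    (forall x, x \in C -> shift M x \in C) ->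
  exists s (h : 'Hom(Nsum s, M)),
    [/\ standard s, equivariant h, injective h, limg h = C &
      forall y, (h y \in mark M) = (y \in mark (Nsum s))].
Proof.
move=> regM C; have [d] := ubnP (\dim C); elim: d C => // d IH C Cd TC.
have [->|Cn0] := eqVneq C 0%VS.
  exists [::], 0; split=> //.
  - by move=> x; rewrite !zero_lfunE linear0.
  - by move=> x y _; rewrite (mzero0 x) (mzero0 y).
  - by rewrite lim0g.
  - by move=> y; rewrite (mzero0 y) linear0 !mem0v.
have [n [x [Cx Tx Tn1 markT]]] := top_vector regM Cn0.
have [_ TU] := regM.
pose sx := shiftn M n x; pose b := sx \in mark M.
have [phi [phi1 phiU]] : exists phi : 'Hom(M, K^o),
    phi sx = 1 /\ (~~ b -> forall u, u \in mark M -> phi u = 0).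
  have [bT|bF] := boolP b.
    have /separating_form[phi [? _]] : sx \notin 0%VS by rewrite memv0.
    by exists phi.
  by have [phi [? ?]] := separating_form bF; exists phi.
(* The coordinates of [Psi y] are the values of [phi] along the orbit of [y]. *)
have Psi_lin : linear (fun y : M => \row_(i < n.+1) phi (shiftn M i y)).
  by move=> a u v; apply/rowP=> i; rewrite !mxE !linearP.
have [Psi PsiE] := lfun_of_linear Psi_lin.
have PsiP y : reflect (forall i, (i <= n)%N -> phi (shiftn M i y) = 0)
    (y \in lker Psi).
  rewrite memv_ker PsiE; apply: (iffP eqP) => [/rowP P0 i i_n|P0].
    by have := P0 (Ordinal (i_n : (i < n.+1)%N)); rewrite !mxE.
  by apply/rowP=> i; rewrite !mxE P0 // -ltnS ltn_ord.
pose C' := (C :&: lker Psi)%VS.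
have TC' y : y \in C' -> shift M y \in C'.
  rewrite !memv_cap => /andP[Cy /PsiP Py]; rewrite TC //=; apply/PsiP=> i i_n.
  rewrite -shiftnS; move: i_n; rewrite leq_eqVlt => /orP[/eqP->|]; last exact: Py.
  by rewrite Tn1 ?linear0.
have C'd : (\dim C' < d)%N.
  rewrite -ltnS (leq_trans _ Cd) // ltnS ltnNge; apply/negP=> le_d.
  have /eqP C'C : C' == C by rewrite eqEdim capvSl.
  have : x \in C' by rewrite C'C.
  rewrite memv_cap => /andP[_ /PsiP/(_ n (leqnn n))/eqP].
  by rewrite phi1 oner_eq0.
have [s [h [/andP[sort_s pos_s] eh h_inj h_im h_mark]]] := IH _ C'd TC'.
pose e := (b, n.+1) : bool * nat.
have [f [ef fx]] := @cyc_hom K e M x (Tn1 _ Cx).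
have [H HE] : {H : 'Hom(msum (cyc K e) (Nsum s), M) |
  forall z, H z = f z.1 + h z.2} := pair_lfun f h.
have fC p : f p \in C.
  rewrite (gen_expand p) linear_sum memv_suml // => i _.
  rewrite linearZ memvZ //= (equivariantn _ _ ef) fx.
  elim: (i : nat) => [|j Cj]; first by rewrite shiftn0.
  by rewrite shiftSn TC.
have hC' y : h y \in C' by rewrite -h_im memv_img ?memvf.
have hC y : h y \in C by apply: (subvP (capvSl _ _)) (hC' y).
have fC'0 p : f p \in C' -> p = 0.
  move=> C'p; apply: contraTeq isT => /cyc_socle[k [c [cn0 Tp]]].
  have : shiftn M k (f p) \in C'.
    elim: (k) => [|j Cj]; first by rewrite shiftn0.
    by rewrite shiftSn TC'.
  rewrite -(equivariantn _ _ ef) Tp linearZ /= (equivariantn _ _ ef) fx.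
  rewrite memv_cap => /andP[_ /PsiP/(_ 0%N (leq0n n))/eqP].
  by rewrite shiftn0 linearZ /= phi1 [_ *: _]mulr1 (negPf cn0).
have f_inj : injective f.
  apply/lker0P; rewrite -subv0; apply/subvP=> p; rewrite memv_ker memv0.
  by move=> /eqP fp; apply/eqP/fC'0; rewrite fp mem0v.
have eH : equivariant H.
  by move=> z; rewrite !HE shift_msum /= ef eh linearD.
have H_inj : injective H.
  apply/lker0P; rewrite -subv0; apply/subvP=> -[p y]; rewrite memv_ker memv0.
  rewrite HE /= addr_eq0 => /eqP fp; have p0 : p = 0.
    by apply: fC'0; rewrite fp memvN.
  move: fp; rewrite p0 linear0 => /esym/eqP; rewrite oppr_eq0 => /eqP hy.
  by have -> : y = 0 by apply: h_inj; rewrite hy linear0.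
(* [C'] has codimension at most [n.+1], the dimension of the block. *)
have CE : (limg f + C')%VS = C.
  apply/eqP; rewrite eqEdim subv_add capvSl andbT; apply/andP; split.
    by apply/subvP=> _ /memv_imgP[p _ ->].
  rewrite dimv_disjoint_sum; last first.
    apply/eqP; rewrite -subv0; apply/subvP=> _ /memv_capP[/memv_imgP[p _ ->]].
    by move=> /fC'0->; rewrite linear0 mem0v.
  rewrite dimv_inj // dim_cyc -(limg_ker_dim Psi C) addnC leq_add2r.
  apply: leq_trans (dimvS (subvf _)) _.
  by rewrite dimvf -[X in (_ <= X)%N]mul1n; apply: leqnn.
exists (e :: s), H; split=> //.
- rewrite /standard /= pos_s /= andbT.
  case: s h eh h_inj h_mark sort_s pos_s hC {h_im HE hC' H eH H_inj}
    => //= e' s h eh h_inj h_mark sort_s /andP[e'_gt0 _] hC.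
  rewrite sort_s andbT; pose z : Nsum (e' :: s) := (gen K e', 0).
  (* The shift has order at most [n.+1] on [C], so no later block is larger. *)
  have le_n : (e'.2 <= n.+1)%N.
    rewrite leqNgt; apply/negP=> lt_n.
    have /(congr1 fst) : shiftn _ n.+1 z = 0.
      by apply: h_inj; rewrite (equivariantn _ _ eh) linear0 Tn1.
    rewrite shiftn_msum /= => Tg; have /eqP[] := gen_socle_neq0 K e'_gt0.
    by apply: (@shiftn_eq0 _ (cyc K e') n.+1 _ _ _ Tg); rewrite -ltnS prednK.
  rewrite /dominates /= le_n /=.
  have [bT|bF] := boolP b; last by rewrite subn0 (leq_trans (leq_subr _ _)).
  (* If [sx] is marked, so is the image of [C] under [n] shifts, hence also the
     socle of any later block of the same size. *)
  case: (ltngtP e'.2 n.+1) le_n => // [e'_n|e'_n] _; first by rewrite subn1 /=; lia.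
  have : shiftn _ n z \in mark (Nsum (e' :: s)).
    by rewrite -h_mark (equivariantn _ _ eh) markT.
  rewrite mem_mark_msum shiftn_msum /= => /andP[+ _]; rewrite mem_mark_cyc.
  have := gen_socle_neq0 K e'_gt0; rewrite e'_n /= => /negPf->.
  by case/andP=> ->.
- rewrite -CE; apply/vspaceP=> u; apply/memv_imgP/memv_addP.
    case=> -[p y] _ ->; rewrite HE; exists (f p); rewrite ?memv_img ?memvf //.
    by exists (h y).
  case=> _ /memv_imgP[p _ ->] [v]; rewrite -h_im => /memv_imgP[y _ ->] ->.
  by exists (p, y); rewrite ?memvf // HE.
- move=> [p y]; rewrite mem_mark_msum HE mem_mark_cyc /= -h_mark.
  apply/idP/idP; last first.
    case/andP=> /orP[/eqP->|/andP[bT /eqP/cyc_ker[c ->]]] hy.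
      by rewrite linear0 add0r.
    by rewrite linearZ /= (equivariantn _ _ ef) fx memvD // memvZ.
  move=> Hu; have Tp : shift (cyc K e) p = 0.
    have : H (shift (msum (cyc K e) (Nsum s)) (p, y)) = H 0.
      by rewrite eH HE (TU _ Hu) linear0.
    by move/H_inj; rewrite shift_msum => /(congr1 fst).
  have [c pE] := cyc_ker Tp; have fpE : f p = c *: sx.
    by rewrite pE linearZ /= (equivariantn _ _ ef) fx.
  have [bT|bF] := boolP b.
    rewrite Tp eqxx orbT /=; move: Hu; rewrite fpE => Hu.
    by rewrite -(addKr (c *: sx) (h y)) memvD // memvN memvZ.
  move: (phiU bF _ Hu); rewrite fpE linearD linearZ /= phi1 [_ *: _]mulr1.
  have /memv_capP[_ /PsiP/(_ 0%N (leq0n n))] := hC' y.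
  rewrite shiftn0 => ->; rewrite addr0 => c0.
  by rewrite pE c0 scale0r eqxx /= -[h y]add0r -(scale0r sx) -c0 -fpE.
Qed.

Theorem decompose M : regular M -> exists2 s, standard s & miso (Nsum s) M.
Proof.
move=> regM.
have [|s [h [std eh h_inj h_im hU]]] := decompose_sub regM (C := fullv).
  by move=> x _; rewrite memvf.
exists s => //; apply: (misoI eh h_inj) => // y.
have /memv_imgP[x _ ->] : y \in limg h by rewrite h_im memvf.
by exists x.
Qed.

End Decomposition.

(** * Truncated sums and dimensions of endomorphism algebras *)

Section TruncatedSums.

Local Open Scope nat_scope.
Implicit Types (l : seq nat).

Definition tsum l n := \sum_(x <- l) minn n x.

Lemma tsum0 l : tsum l 0 = 0.
Proof. by rewrite /tsum big1 // => x _; rewrite min0n. Qed.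

Lemma tsumS l n : tsum l n.+1 = tsum l n + count (ltn n) l.
Proof.
elim: l => [|x l IH]; rewrite /tsum ?big_nil // !big_cons /= -!/(tsum _ _) IH.
by case: ltnP; lia.
Qed.

Lemma tsum_large l n : (forall x, x \in l -> x <= n) -> tsum l n = sumn l.
Proof.
by move=> le_n; rewrite sumnE; apply: eq_big_seq => x /le_n/minn_idPr.
Qed.

Lemma leq_sumn l x : x \in l -> x <= sumn l.
Proof.
elim: l => //= y l IH; rewrite inE => /orP[/eqP->|/IH]; first exact: leq_addr.
by move/leq_trans; apply; apply: leq_addl.
Qed.

Lemma eq_count_ltn l l' n :
  tsum l =1 tsum l' -> count (ltn n) l = count (ltn n) l'.
Proof. by move=> eq_t; have := eq_t n.+1; rewrite !tsumS eq_t => /addnI. Qed.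

(** The increments of [tsum] count the entries larger than a given bound. *)
Lemma eq_sorted_tsum l l' : sorted geq l -> sorted geq l' ->
  size l = size l' -> tsum l =1 tsum l' -> l = l'.
Proof.
move=> sl sl' eq_size eq_t; apply: (sorted_eq _ _ sl sl').
- by move=> y x z /= yx zy; apply: leq_trans zy yx.
- by move=> x y /= /andP[yx xy]; apply/eqP; rewrite eqn_leq yx xy.
have eq_c n : count (leq n) l = count (leq n) l'.
  case: n => [|n]; last exact: eq_count_ltn.
  by rewrite !(eq_count (a2 := predT)) // !count_predT.
have split_c m x : count (leq x) m = count_mem x m + count (ltn x) m.
  elim: m => //= y m ->; case: (ltngtP x y) => _; lia.
apply/allP=> x _ /=; apply/eqP; apply: (@addIn (count (ltn x) l)).
by rewrite -split_c (eq_count_ltn x eq_t) -split_c eq_c.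
Qed.

(** [tsum l] is concave, and [tsum l'] is affine between consecutive entries
    of [l']; a concave function below an affine one that meets it at both ends
    coincides with it. In the proof, from the first point where [tsum l] is
    smaller it grows more slowly than [tsum l'], and this goes on forever since
    the slope of [tsum l'] can only change at an entry of [l'], where the two
    functions agree; but they have the same limit. *)
Lemma tsum_concave l l' : (forall n, tsum l n <= tsum l' n) ->
    sumn l = sumn l' -> (forall x, x \in l' -> tsum l x = tsum l' x) ->
  tsum l =1 tsum l'.
Proof.
move=> le_t eq_s eq_t n; apply/eqP; rewrite eqn_leq le_t leqNgt /=.
apply/negP=> lt_n.
have [n0 lt_n0 n0_min] := ex_minnP (ex_intro (fun n => tsum l n < tsum l' n) n lt_n).
case: n0 => [|k] in lt_n0 n0_min *; first by move: lt_n0; rewrite !tsum0.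
have eq_k : tsum l k = tsum l' k.
  apply/eqP; rewrite eqn_leq le_t leqNgt; apply/negP=> /n0_min.
  by rewrite ltnn.
have c_anti m j : count (ltn (m + j)) l <= count (ltn m) l.
  by apply: sub_count => x /=; apply: leq_ltn_trans (leq_addr _ _).
have c'_const j : tsum l j.+1 < tsum l' j.+1 ->
    count (ltn j.+1) l' = count (ltn j) l'.
  move=> lt_j; apply: eq_in_count => x xl'; rewrite [LHS]/= [RHS]/=.
  rewrite ltn_neqAle andb_idl //.
  by move=> _; apply: contraTneq lt_j => ->; rewrite eq_t // ltnn.
have lt_c : count (ltn k) l < count (ltn k) l'.
  by move: lt_n0; rewrite !tsumS eq_k ltn_add2l.
have always j : tsum l (k + j).+1 < tsum l' (k + j).+1 /\
    count (ltn (k + j)) l' = count (ltn k) l'.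
  elim: j => [|j [lt_j c_j]]; first by rewrite addn0.
  rewrite addnS c'_const // c_j; split=> //.
  rewrite (tsumS l) (tsumS l') c'_const // c_j.
  have := c_anti k j.+1; rewrite addnS; lia.
have [+ _] := always (sumn l + sumn l').
rewrite !tsum_large ?eq_s ?ltnn // => x /leq_sumn; lia.
Qed.

End TruncatedSums.

Section TypeCombinatorics.

Local Open Scope nat_scope.
Implicit Types (s t : seq (bool * nat)).

Definition betas s := [seq e.2 | e <- s].
Definition gammas s := [seq e.2 - e.1 | e : bool * nat <- s].
Definition nmarks s := \sum_(e <- s) e.1.

Lemma standard_pos s : standard s -> forall e, e \in s -> 0 < e.2.
Proof. by case/andP=> _ /allP. Qed.

Lemma standard_betas s : standard s -> sorted geq (betas s).
Proof.
by case/andP=> + _; apply: homo_sorted => e e' /andP[].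
Qed.

Lemma standard_gammas s : standard s -> sorted geq (gammas s).
Proof.
by case/andP=> + _; apply: homo_sorted => e e' /andP[].
Qed.

Lemma sumn_betas s : (forall e, e \in s -> 0 < e.2) ->
  sumn (betas s) = sumn (gammas s) + nmarks s.
Proof.
move=> pos; rewrite !sumnE !big_map -big_split; apply: eq_big_seq => e /pos /=.
lia.
Qed.

Lemma betas_gammas_inj s t : (forall e, e \in s -> 0 < e.2) ->
    (forall e, e \in t -> 0 < e.2) ->
  betas s = betas t -> gammas s = gammas t -> s = t.
Proof.
elim: s t => [|[b m] s IH] [|[b' m'] t] //= pos_s pos_t [<- eb] [eg1 eg].
rewrite (IH t) //; last 2 first.
- by move=> e es; apply: pos_s; rewrite inE es orbT.
- by move=> e es; apply: pos_t; rewrite inE es orbT.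
have /= := pos_s _ (mem_head _ _); move: eg1.
by case: b {pos_s pos_t}; case: b' => //; lia.
Qed.

Lemma standard_inj s t : standard s -> standard t ->
    tsum (betas s) =1 tsum (betas t) -> tsum (gammas s) =1 tsum (gammas t) ->
  s = t.
Proof.
move=> std_s std_t eb eg.
have pos_size r : standard r -> count (ltn 0) (betas r) = size r.
  by move=> /standard_pos pos; rewrite -[RHS](size_map snd); apply/eqP;
    rewrite -all_count; apply/allP => _ /mapP[e /pos ? ->].
have eq_size : size s = size t by rewrite -!pos_size // (eq_count_ltn _ eb).
apply: betas_gammas_inj (standard_pos _) (standard_pos _) _ _ => //.
- by apply: eq_sorted_tsum eb; rewrite ?standard_betas // !size_map.
- by apply: eq_sorted_tsum eg; rewrite ?standard_gammas // !size_map.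
Qed.

(** The dimension of the space of morphisms from [Nsum s] to [Nsum t], see
    [dim_mhom_Nsum]. *)
Definition hdim s t :=
  \sum_(e <- s) (if e.1 then nmarks t + tsum (gammas t) e.2.-1
                 else tsum (betas t) e.2).

(** The same number computed from the maps into the blocks of the target: a
    map into an unmarked block factors through the quotient by the mark. *)
Lemma hdimE s t : (forall e, e \in s -> 0 < e.2) ->
    (forall e, e \in t -> 0 < e.2) ->
  hdim s t = \sum_(e <- t) (if e.1 then tsum (betas s) e.2
                            else tsum (gammas s) e.2).
Proof.
move=> pos_s pos_t.
pose h (e e' : bool * nat) := if e.1 then e'.1 + minn e.2.-1 (e'.2 - e'.1)
  else minn e.2 e'.2.
transitivity (\sum_(e <- s) \sum_(e' <- t) h e e').
  apply: eq_bigr => e _; rewrite /h /nmarks /tsum !big_map.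
  by case: e.1 => //; rewrite -big_split.
rewrite exchange_big; apply: eq_big_seq => -[b' m'] /pos_t/= m'_gt0.
case: b'; rewrite /tsum big_map; apply: eq_big_seq => -[b m] /pos_s;
  by rewrite /h; case: b => /= m_gt0; lia.
Qed.

Lemma leq_sum_eq (T : eqType) (r : seq T) (F G : T -> nat) :
    (forall x, x \in r -> F x <= G x) ->
    \sum_(x <- r) F x = \sum_(x <- r) G x ->
  forall x, x \in r -> F x = G x.
Proof.
elim: r => // y r IH le_FG; rewrite !big_cons => eqs x.
have le_r z : z \in r -> F z <= G z by move=> zr; rewrite le_FG // inE zr orbT.
have le_sum : \sum_(z <- r) F z <= \sum_(z <- r) G z.
  by rewrite big_seq [X in _ <= X]big_seq; apply: leq_sum => z; apply: le_r.
have le_y := le_FG y (mem_head _ _).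
rewrite inE => /orP[/eqP->|xr]; first lia.
by apply: IH xr => //; lia.
Qed.

Section Minimality.

Variables s t : seq (bool * nat).
Hypotheses (std_s : standard s) (std_t : standard t).
Hypothesis le_betas : forall n, tsum (betas s) n <= tsum (betas t) n.
Hypothesis le_gammas : forall n, tsum (gammas s) n <= tsum (gammas t) n.
Hypothesis eq_nmarks : nmarks s = nmarks t.
Hypothesis eq_total : sumn (betas s) = sumn (betas t).

Let pos_s := standard_pos std_s.
Let pos_t := standard_pos std_t.

Lemma hdim_monor r : hdim r s <= hdim r t.
Proof. by apply: leq_sum => e _; rewrite eq_nmarks; case: e.1; rewrite ?leq_add2l. Qed.

Lemma hdim_monol r : standard r -> hdim s r <= hdim t r.
Proof.
move=> /standard_pos pos_r; rewrite !hdimE //.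
by apply: leq_sum => e _; case: e.1.
Qed.

Lemma hdim_min : hdim s s <= hdim t t.
Proof. exact: leq_trans (hdim_monor s) (hdim_monol std_t). Qed.

(** Equality has to hold in both chains of inequalities
    hdim s s <= hdim s t <= hdim t t and hdim s s <= hdim t s <= hdim t t, and
    there term by term. Each block of [t] contributes one part to [betas t] and
    one to [gammas t]; the agreement of the truncated sums at one of these parts
    comes from the first chain, at the other one from the second chain. This is
    what [tsum_concave] requires. *)
Lemma hdim_min_eq : hdim s s = hdim t t -> s = t.
Proof.
move=> eq_h.
have eq1 : hdim s t = hdim t t.
  by apply/eqP; rewrite eqn_leq hdim_monol // -eq_h hdim_monor.
have eq2 : hdim t s = hdim t t.
  by apply/eqP; rewrite eqn_leq hdim_monor -eq_h hdim_monol.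
have eqg0 : sumn (gammas s) = sumn (gammas t).
  by move: eq_total; rewrite !sumn_betas // eq_nmarks => /addIn.
have eq_right e : e \in t ->
    (if e.1 then tsum (betas s) e.2 = tsum (betas t) e.2
     else tsum (gammas s) e.2 = tsum (gammas t) e.2).
  move: eq1; rewrite !hdimE // => /leq_sum_eq eq1' et.
  have := eq1' _ e et; case: e.1; apply=> x _;
    by case: x.1; rewrite ?le_betas ?le_gammas.
have eq_left e : e \in t ->
    (if e.1 then tsum (gammas s) e.2.-1 = tsum (gammas t) e.2.-1
     else tsum (betas s) e.2 = tsum (betas t) e.2).
  move: eq2 => /leq_sum_eq eq2' et.
  have := eq2' _ e et; rewrite eq_nmarks.
  by case: e.1 => /= eq2e; [apply: (@addnI (nmarks t)) |]; apply: eq2e => x _;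
    case: x.1; rewrite ?leq_add2l ?le_betas ?le_gammas.
apply: standard_inj => //; apply: tsum_concave => // _ /mapP[[b m] et ->] /=.
  by have := eq_right _ et; have := eq_left _ et; case: b {et}.
by have := eq_right _ et; have := eq_left _ et; case: b {et} => /=;
  rewrite ?subn1 ?subn0.
Qed.

End Minimality.

End TypeCombinatorics.

(** * Classification, and dimensions of spaces of morphisms *)

Section Morphisms.

Variable K : fieldType.
Implicit Types (M N : marked K) (s : seq (bool * nat)).

Lemma kdim_tsum s n : kdim (Nsum K s) n = tsum (betas s) n.
Proof. by rewrite kdim_Nsum /tsum big_map. Qed.

Lemma mdim_tsum s n : (forall e, e \in s -> 0 < e.2)%N ->
  mdim (Nsum K s) n = (nmarks s + tsum (gammas s) n)%N.
Proof.
move=> pos; rewrite mdim_Nsum; last by apply/allP=> e /pos; case: e.1.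
by rewrite /nmarks /tsum big_map -big_split.
Qed.

Lemma miso_of_dims M N : regular M -> regular N ->
  kdim M =1 kdim N -> mdim M =1 mdim N -> miso M N.
Proof.
move=> /decompose[s std_s iM] /decompose[t std_t iN] eqk eqm.
suff st : s = t.
  by rewrite -st in iN; apply: miso_trans iN; apply: miso_sym.
have eqb : tsum (betas s) =1 tsum (betas t).
  by move=> n; rewrite -!kdim_tsum (kdim_miso n iM) (kdim_miso n iN).
have eqg n : (nmarks s + tsum (gammas s) n = nmarks t + tsum (gammas t) n)%N.
  rewrite -!mdim_tsum ?(mdim_miso n iM) ?(mdim_miso n iN) //;
    exact: standard_pos.
have eq_m : nmarks s = nmarks t by have := eqg 0%N; rewrite !tsum0 !addn0.
apply: standard_inj => // n; apply: (@addnI (nmarks s)).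
by rewrite eqg eq_m.
Qed.

(** Vanishes exactly on the morphisms of marked operators, which makes these
    a subspace of the space of linear maps. *)
Definition mhom_defect M N (f : 'Hom(M, N)) : ('Hom(M, N) * 'Hom(M, N))%type :=
  ((f \o shift M)%VF - (shift N \o f)%VF,
   ((\1 - projv (mark N)) \o f \o projv (mark M))%VF).

Lemma mhom_defect_linear M N : linear (@mhom_defect M N).
Proof.
move=> a f g; congr pair; apply/lfunP=> x /=;
  rewrite !(add_lfunE, opp_lfunE, scale_lfunE, comp_lfunE) !linearP /=;
  by rewrite scalerDr addrACA.
Qed.

Definition mhom M N : {vspace 'Hom(M, N)} :=
  lker (sval (lfun_of_linear (@mhom_defect_linear M N))).

Lemma mem_mhom M N (f : 'Hom(M, N)) :
  f \in mhom M N <->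
  equivariant f /\ (forall u, u \in mark M -> f u \in mark N).
Proof.
rewrite memv_ker (svalP (lfun_of_linear (@mhom_defect_linear M N))) /mhom_defect.
split=> [/eqP[/subr0_eq eT eU]|[ef fU]].
  split=> [x|u Uu].
    by have /lfunP/(_ x) := eT; rewrite !comp_lfunE.
  have /lfunP/(_ u)/eqP := eU.
  rewrite !comp_lfunE zero_lfunE projv_id // add_lfunE opp_lfunE id_lfunE.
  by rewrite subr_eq0 => /eqP->; apply: memv_proj.
apply/eqP; congr pair; apply/lfunP=> x; rewrite zero_lfunE.
  by rewrite add_lfunE opp_lfunE !comp_lfunE ef subrr.
have /fU fUx := memv_proj (mark M) x.
by rewrite !comp_lfunE add_lfunE opp_lfunE id_lfunE (projv_id fUx) subrr.
Qed.

Lemma dim_mhom_msum M M' N :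
  \dim (mhom (msum M M') N) = (\dim (mhom M N) + \dim (mhom M' N))%N.
Proof.
have F_lin : linear (fun f : 'Hom(msum M M', N) =>
    ((f \o inlv M M')%VF, (f \o inrv M M')%VF)).
  move=> a f g; congr pair; apply/lfunP=> x /=;
    by rewrite !(add_lfunE, scale_lfunE, comp_lfunE).
have [F FE] := lfun_of_linear F_lin.
rewrite -dim_prodv; apply: (dimv_bij (f := F)) => [f|f _|[g g']].
- case/mem_mhom=> ef fU; rewrite mem_prodv FE; apply/andP; split; apply/mem_mhom;
    split=> x; rewrite !comp_lfunE ?inlvE ?inrvE.
  + by rewrite -ef shift_msum /= linear0.
  + by move=> Ux; apply: fU; rewrite mem_mark_msum Ux mem0v.
  + by rewrite -ef shift_msum /= linear0.
  + by move=> Ux; apply: fU; rewrite mem_mark_msum Ux mem0v.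
- rewrite FE => -[/lfunP f1 /lfunP f2]; apply/lfunP=> -[x y].
  transitivity ((f \o inlv M M')%VF x + (f \o inrv M M')%VF y); last first.
    by rewrite f1 f2 !zero_lfunE addr0.
  rewrite !comp_lfunE -linearD inlvE inrvE; congr (f _); congr pair => /=.
    by rewrite addr0.
  by rewrite add0r.
- rewrite mem_prodv => /andP[/mem_mhom[eg gU] /mem_mhom[eg' gU']].
  have [f fE] : {f : 'Hom(msum M M', N) | forall z, f z = g z.1 + g' z.2} :=
    pair_lfun g g'.
  exists f.
    apply/mem_mhom; split=> [z|z]; first by rewrite !fE shift_msum eg eg' linearD.
    by rewrite mem_mark_msum fE => /andP[/gU ? /gU' ?]; rewrite memvD.
  rewrite FE; congr pair; apply/lfunP=> x; rewrite comp_lfunE fE ?inlvE ?inrvE /=;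
    by rewrite linear0 ?addr0 ?add0r.
Qed.

Lemma dim_mhom_mzero N : \dim (mhom (mzero K) N) = 0%N.
Proof.
apply/eqP; rewrite dimv_eq0 -subv0; apply/subvP=> f _; rewrite memv0.
by apply/eqP/lfunP=> x; rewrite (mzero0 x) !linear0.
Qed.

(** Evaluation at the generator: its image must be killed by [e.2] shifts and,
    if the socle is marked, it must reach the mark after [e.2.-1] shifts, which
    implies the first condition. *)
Lemma dim_mhom_cyc e N : regular N -> (0 < e.2)%N ->
  \dim (mhom (cyc K e) N) = if e.1 then mdim N e.2.-1 else kdim N e.2.
Proof.
move=> [_ TU] m_gt0.
have F_lin : linear (fun f : 'Hom(cyc K e, N) => f (gen K e)).
  by move=> a f g; rewrite !(add_lfunE, scale_lfunE).
have [F FE] := lfun_of_linear F_lin.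
have socleT : shift (cyc K e) (shiftn (cyc K e) e.2.-1 (gen K e)) = 0.
  by rewrite -shiftSn prednK // gen_order.
have F_inj f : f \in mhom (cyc K e) N -> F f = 0 -> f = 0.
  by move=> /mem_mhom[ef _]; rewrite FE; apply: cyc_hom_eq0.
case e1: e.1; apply: (dimv_bij (f := F)) => //.
- move=> f /mem_mhom[ef fU]; rewrite FE -memv_preim -(equivariantn _ _ ef) fU //.
  by rewrite mem_mark_cyc e1 socleT eqxx orbT.
- move=> y; rewrite -memv_preim => Ty.
  have [|f [ef fy]] := @cyc_hom K e N y.
    by rewrite -[e.2]prednK // shiftSn TU.
  exists f; rewrite ?FE //; apply/mem_mhom; split=> // u; rewrite mem_mark_cyc.
  case/orP=> [/eqP->|/andP[_ /eqP/cyc_ker[c ->]]]; first by rewrite linear0 mem0v.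
  by rewrite linearZ /= (equivariantn _ _ ef) fy memvZ.
- move=> f /mem_mhom[ef _]; rewrite FE memv_ker -(equivariantn _ _ ef).
  by rewrite gen_order linear0.
- move=> y; rewrite memv_ker => /eqP Ty; have [f [ef fy]] := @cyc_hom K e N y Ty.
  exists f; rewrite ?FE //; apply/mem_mhom; split=> // u; rewrite mem_mark_cyc e1.
  by rewrite orbF => /eqP->; rewrite linear0 mem0v.
Qed.

Lemma dim_mhom_Nsum s t : (forall e, e \in s -> 0 < e.2)%N ->
    (forall e, e \in t -> 0 < e.2)%N ->
  \dim (mhom (Nsum K s) (Nsum K t)) = hdim s t.
Proof.
move=> + pos_t; elim: s => [|e s IH] pos_s; first by rewrite dim_mhom_mzero /hdim big_nil.
rewrite /hdim big_cons -/(hdim s t) -IH => [|e' es]; last first.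
  by apply: pos_s; rewrite inE es orbT.
rewrite dim_mhom_msum dim_mhom_cyc; last 2 first.
- exact: regular_Nsum.
- by apply: pos_s; apply: mem_head.
by rewrite mdim_tsum // kdim_tsum.
Qed.

Lemma dim_mhom_miso M N : miso M N -> \dim (mhom M M) = \dim (mhom N N).
Proof.
move=> [h [k [eh hK kK hU kU]]]; have ek := miso_inv_equivariant eh hK kK.
have F_lin : linear (fun f : 'End(M) => (h \o f \o k)%VF).
  move=> a f g; apply/lfunP=> x.
  by rewrite !(add_lfunE, scale_lfunE, comp_lfunE) linearP.
have [F FE] := lfun_of_linear F_lin.
apply: (dimv_bij (f := F)) => [f /mem_mhom[ef fU]|f _|f /mem_mhom[ef fU]].
- rewrite FE; apply/mem_mhom; split=> x; rewrite !comp_lfunE.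
    by rewrite ek ef eh.
  by move=> /kU/fU/hU.
- rewrite FE => /lfunP F0; apply/lfunP=> x; have := F0 (h x).
  rewrite !comp_lfunE hK !zero_lfunE => hfx.
  by rewrite -[f x]hK hfx linear0.
- exists (k \o f \o h)%VF; last first.
    by rewrite FE; apply/lfunP=> x; rewrite !comp_lfunE !kK.
  apply/mem_mhom; split=> x; rewrite !comp_lfunE; first by rewrite eh ef ek.
  by move=> /hU/fU/kU.
Qed.

End Morphisms.

(** * Sums of the largest parts *)

Section TopSums.

Local Open Scope nat_scope.
Implicit Types (l : seq nat).

Definition top k l := sumn (take k l).

Lemma top_cons k x l : top k.+1 (x :: l) = x + top k l.
Proof. by []. Qed.

Lemma top0 l : top 0 l = 0.
Proof. by rewrite /top take0. Qed.

Lemma top_nil k : top k [::] = 0.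
Proof. by []. Qed.

Lemma sorted_geq_head x l : sorted geq (x :: l) -> forall y, y \in l -> y <= x.
Proof.
rewrite /= (path_sortedE (leT := geq)) => [/andP[/allP] //|].
by move=> a b c /= ab ca; apply: leq_trans ca ab.
Qed.

Lemma count_ltn0 l n : (forall y, y \in l -> y <= n) -> count (ltn n) l = 0.
Proof.
move=> le_n; apply/eqP; rewrite -leqn0 leqNgt -has_count.
by apply/hasPn => y /le_n; rewrite /= -leqNgt.
Qed.

(** The sum of the [k] largest parts counts the boxes of the first [k] rows of
    a Young diagram; the left-hand side counts them column by column. *)
Lemma top_count N k l : sorted geq l -> (forall x, x \in l -> x <= N) ->
  \sum_(n < N) minn k (count (ltn n) l) = top k l.
Proof.
elim: l k => [|x l IH] k.
  by move=> _ _; rewrite top_nil big1 // => n _; rewrite minn0.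
case: k => [|k] xl le_N; first by rewrite top0 big1 // => n _; rewrite min0n.
have x_max := sorted_geq_head xl.
have x_N : x <= N by apply: le_N; apply: mem_head.
rewrite top_cons -(IH k); last 2 first.
- exact: path_sorted xl.
- by move=> y yl; rewrite le_N // inE yl orbT.
have xE : x = \sum_(n < N) (n < x).
  rewrite -[LHS]subn0 -[LHS]muln1 -sum_nat_const_nat big_mkord.
  rewrite (big_ord_widen N (fun=> 1)) // big_mkcond /=.
  by apply: eq_bigr => n _; case: ltnP.
rewrite [X in _ = X + _]xE -big_split; apply: eq_bigr => n _ /=.
case: ltnP => [_|x_n] /=; first lia.
rewrite count_ltn0 ?minn0 // => y /x_max y_x; exact: leq_trans y_x x_n.
Qed.

(** What [tsum] truncates. *)
Definition excess l n := \sum_(x <- l) (x - n).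

Lemma tsum_excess l n : tsum l n + excess l n = sumn l.
Proof.
rewrite /tsum /excess; elim: l => [|x l IH]; rewrite ?big_nil // !big_cons /=.
by rewrite -IH; lia.
Qed.

Lemma top_excess k l n : top k l <= excess l n + k * n.
Proof.
rewrite /excess; elim: l k => [|x l IH] [|k]; rewrite ?top0 ?top_nil //.
by rewrite top_cons big_cons; have := IH k; lia.
Qed.

Lemma top_excess_eq l n : sorted geq l ->
  top (count (ltn n) l) l = excess l n + count (ltn n) l * n.
Proof.
rewrite /excess; elim: l => [|x l IH] xl; first by rewrite big_nil.
rewrite /= big_cons; case: ltnP => [n_x|x_n].
  by rewrite add1n top_cons IH ?(path_sorted xl) //; lia.
have x_max := sorted_geq_head xl.
rewrite count_ltn0 => [|y /x_max y_x]; last exact: leq_trans y_x x_n.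
rewrite top0 big1_seq => [|y /andP[_ /x_max]]; lia.
Qed.

(** The dominance order reverses truncated sums: [excess l n] is the maximum
    over [k] of [top k l - k * n], and it is attained at the number of parts
    larger than [n]. *)
Lemma tsum_le_top l l' : sorted geq l' -> sumn l = sumn l' ->
  (forall k, top k l' <= top k l) -> forall n, tsum l n <= tsum l' n.
Proof.
move=> sl' eq_s le_top n.
have := le_top (count (ltn n) l'); rewrite top_excess_eq //.
have := top_excess (count (ltn n) l') l n.
have := tsum_excess l n; have := tsum_excess l' n; rewrite eq_s; lia.
Qed.

Lemma top_betas (s : seq (bool * nat)) k : (forall e, e \in s -> 0 < e.2) ->
  top k (betas s) = top k (gammas s) + nmarks (take k s).
Proof.
move=> pos; rewrite /top /betas /gammas -!map_take sumn_betas //.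
by move=> e /mem_take; apply: pos.
Qed.

Lemma top_count_betas N k s : standard s -> sumn (betas s) <= N ->
  \sum_(n < N) minn k (count (ltn n) (betas s)) = top k (betas s).
Proof.
move=> std_s le_N; apply: top_count (standard_betas std_s) _ => x /leq_sumn x_le.
exact: leq_trans x_le le_N.
Qed.

Lemma top_count_gammas N k s : standard s -> sumn (betas s) <= N ->
  \sum_(n < N) minn k (count (ltn n) (gammas s)) = top k (gammas s).
Proof.
move=> std_s le_N; apply: top_count (standard_gammas std_s) _ => _ /mapP[e es ->].
have /leq_sumn e_le : e.2 \in betas s by apply: map_f.
exact: leq_trans (leq_subr _ _) (leq_trans e_le le_N).
Qed.

End TopSums.

(** * Submodules with a bounded number of generators *)

Section Subquotients.

Variable K : fieldType.
Variable M : marked K.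
Implicit Types (A B C V W : {vspace M}) (n k N : nat).

Definition stable V := (shift M @: V <= V)%VS.

Lemma stableP V : reflect (forall x, x \in V -> shift M x \in V) (stable V).
Proof.
apply: (iffP subvP) => [sV x Vx|sV _ /memv_imgP[x Vx ->]]; last exact: sV.
by apply: sV; apply: memv_img.
Qed.

Lemma stable_cap V W : stable V -> stable W -> stable (V :&: W).
Proof.
move=> /stableP sV /stableP sW; apply/stableP=> x; rewrite !memv_cap.
by case/andP=> /sV-> /sW->.
Qed.

Lemma stable_add V W : stable V -> stable W -> stable (V + W).
Proof. by move=> sV sW; rewrite /stable limgD addvS. Qed.

Lemma stable0 : stable 0.
Proof. by rewrite /stable limg0 subvv. Qed.

Lemma limg_shiftnS n V : (shiftn M n.+1 @: V = shift M @: (shiftn M n @: V))%VS.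
Proof. by rewrite -limg_comp. Qed.

Lemma stable_shiftn n V : stable V -> stable (shiftn M n @: V).
Proof.
move=> sV; elim: n => [|n IH]; first by rewrite lim1g.
by rewrite limg_shiftnS /stable limgS.
Qed.

Lemma shiftn_sub n V : stable V -> (shiftn M n.+1 @: V <= shiftn M n @: V)%VS.
Proof. by move=> sV; rewrite limg_shiftnS; apply: stable_shiftn. Qed.

(** Rank-nullity for the operator induced on [W / A]: its cokernel and its
    kernel have the same dimension. *)
Lemma coker_ker A W : stable A -> stable W -> (A <= W)%VS ->
  (\dim W + \dim A = \dim (shift M @: W + A)
                     + \dim (W :&: (shift M @^-1: A)))%N.
Proof.
move=> sA sW AW; set W' := (W :&: _)%VS.
have TW' : (shift M @: W')%VS = (shift M @: W :&: A)%VS.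
  apply/vspaceP=> y; rewrite memv_cap; apply/memv_imgP/andP.
    by case=> x; rewrite memv_cap -memv_preim => /andP[Wx Ax] ->; rewrite memv_img.
  case=> /memv_imgP[x Wx ->] Ax; exists x => //.
  by rewrite memv_cap Wx -memv_preim.
have kerW' : (W' :&: lker (shift M))%VS = (W :&: lker (shift M))%VS.
  apply/vspaceP=> x; rewrite !memv_cap -memv_preim memv_ker.
  by case: (x \in W) => //=; apply/andb_idl => /eqP->; rewrite mem0v.
have := dimv_sum_cap (shift M @: W) A; have := limg_ker_dim (shift M) W.
have := limg_ker_dim (shift M) W'; rewrite TW' kerW'; lia.
Qed.

(** Conjugate partition of the type of [B / A]: the number of Jordan blocks of
    size larger than [n]. *)
Definition nblocks A B n :=
  (\dim (shiftn M n @: B + A) - \dim (shiftn M n.+1 @: B + A))%N.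

Lemma layer_sub A B n : stable B ->
  (\dim (shiftn M n.+1 @: B + A) <= \dim (shiftn M n @: B + A))%N.
Proof. by move=> sB; rewrite dimvS // addvS // shiftn_sub. Qed.

(** Counting blocks by their socles instead of their tops; unlike the tops,
    the socles of a submodule embed into those of the module. *)
Lemma nblocks_socle A B n : stable A -> stable B ->
  (nblocks A B n + \dim A =
   \dim ((shiftn M n @: B + A) :&: (shift M @^-1: A)))%N.
Proof.
move=> sA sB; have sBn := stable_add (stable_shiftn n sB) sA.
have := coker_ker sA sBn (addvSr _ _).
rewrite limgD -limg_shiftnS -addvA (addv_idPr sA) /nblocks.
have := layer_sub A n sB; lia.
Qed.

Lemma nblocks_mono A V B n : stable A -> stable V -> stable B ->
  (V <= B)%VS -> (nblocks A V n <= nblocks A B n)%N.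
Proof.
move=> sA sV sB VB; rewrite -(leq_add2r (\dim A)) !nblocks_socle //.
by rewrite dimvS // capvS // addvS // limgS.
Qed.

Lemma nblocks_anti A V n : stable A -> stable V ->
  (nblocks A V n <= nblocks A V 0)%N.
Proof.
move=> sA sV; rewrite -(leq_add2r (\dim A)) !nblocks_socle //.
rewrite dimvS // capvS // addvS // lim1g.
elim: n => [|n IH]; first by rewrite lim1g.
exact: subv_trans (shiftn_sub _ sV) IH.
Qed.

Lemma dim_layers A V N : stable V -> (forall x, shiftn M N x = 0) ->
  \dim (V + A) = (\dim A + \sum_(n < N) nblocks A V n)%N.
Proof.
move=> sV TN; have -> : \dim A = \dim (shiftn M N @: V + A).
  congr (\dim _); symmetry; apply/addv_idPr/subvP=> _ /memv_imgP[x _ ->].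
  by rewrite TN mem0v.
have -> : (V + A = shiftn M 0 @: V + A)%VS by rewrite lim1g.
elim: N {TN} => [|N IH]; first by rewrite big_ord0 addn0.
rewrite IH big_ord_recr /= addnCA [RHS]addnC; congr addn.
by rewrite /nblocks addnC subnK ?layer_sub.
Qed.

(** The hypothesis on [k] says that [V / A] is generated by [k] elements. It
    has then at most [k] blocks, and for each [n] at most as many blocks of size
    larger than [n] as [B / A]. *)
Lemma sub_bound A V B k N : stable A -> stable V -> stable B ->
    (forall x, shiftn M N x = 0) -> (A <= V)%VS -> (V <= B)%VS ->
    (\dim V <= \dim (shift M @: V + A) + k)%N ->
  (\dim V <= \dim A + \sum_(n < N) minn k (nblocks A B n))%N.
Proof.
move=> sA sV sB TN AV VB gen_k.
rewrite -{1}(addv_idPl AV) (dim_layers A sV TN) leq_add2l; apply: leq_sum => n _.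
rewrite leq_min nblocks_mono // andbT (leq_trans (nblocks_anti _ _ _)) //.
rewrite /nblocks lim1g (addv_idPl AV) limg_shiftnS lim1g; lia.
Qed.

Lemma dim_quotient_le (P Q B : {vspace M}) : (Q <= P)%VS ->
  (\dim (P + B) + \dim Q <= \dim (Q + B) + \dim P)%N.
Proof.
move=> QP; have := dimv_sum_cap P B; have := dimv_sum_cap Q B.
have := dimvS (capvS QP (subvv B)); lia.
Qed.

(** [B] cuts [V / A] into the pieces [(V :&: B) / (A :&: B)] and
    [(V + B) / (A + B)]. Both have [k] generators: the second one as a quotient
    of [V / A], the first one as a submodule of it, for which the number of
    generators is best measured by the socle ([coker_ker]). *)
Lemma filtration_bound A B V k N : stable A -> stable B -> stable V ->
    (forall x, shiftn M N x = 0) -> (A <= V)%VS ->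
    (\dim V <= \dim (shift M @: V + A) + k)%N ->
  (\dim V <= \dim A + \sum_(n < N) minn k (nblocks (A :&: B) B n)
             + \sum_(n < N) minn k (nblocks (A + B) fullv n))%N.
Proof.
move=> sA sB sV TN AV gen_k.
have sAB := stable_cap sA sB; have sVB := stable_cap sV sB.
have sApB := stable_add sA sB; have sVpB := stable_add sV sB.
have sf : stable fullv by apply: subvf.
have b1 : (\dim (V :&: B) <= \dim (A :&: B)
    + \sum_(n < N) minn k (nblocks (A :&: B) B n))%N.
  apply: sub_bound => //; rewrite ?capvS ?subvv ?capvSr //.
  set S := (V :&: (shift M @^-1: A))%VS.
  have AS : (A <= S)%VS.
    rewrite subv_cap AV; apply/subvP=> x Ax; rewrite -memv_preim.
    by have /stableP-> := sA.
  have SB : (V :&: B :&: (shift M @^-1: (A :&: B)) = S :&: B)%VS.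
    apply/vspaceP=> x; rewrite !memv_cap -!memv_preim memv_cap.
    case: (x \in V) => //=; case Bx: (x \in B); rewrite ?andbF //= !andbT.
    by have /stableP-> := sB; rewrite ?andbT.
  have := coker_ker sAB sVB (capvS AV (subvv B)); rewrite SB.
  have := coker_ker sA sV AV; rewrite -/S.
  have := dimv_sum_cap S B; have := dimv_sum_cap A B.
  have := dimvS (addvS AS (subvv B)); lia.
have b2 : (\dim (V + B) <= \dim (A + B)
    + \sum_(n < N) minn k (nblocks (A + B) fullv n))%N.
  apply: sub_bound => //; rewrite ?addvS ?subvv ?subvf //.
  have -> : (shift M @: (V + B) + (A + B) = (shift M @: V + A) + B)%VS.
    rewrite limgD -!addvA; congr (_ + _)%VS.
    by rewrite addvC -addvA [(B + _)%VS]addvC (addv_idPr sB).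
  have QV : (shift M @: V + A <= V)%VS by rewrite subv_add AV andbT.
  have := dim_quotient_le B QV; lia.
have := dimv_sum_cap V B; have := dimv_sum_cap A B; lia.
Qed.

Lemma dim_shiftn_add n A :
  (\dim (shiftn M n @: fullv + A) + \dim (shiftn M n @^-1: A)
   = \dim (fullv : {vspace M}) + \dim A)%N.
Proof.
have TP : (shiftn M n @: (shiftn M n @^-1: A) = limg (shiftn M n) :&: A)%VS.
  apply/vspaceP=> y; rewrite memv_cap; apply/memv_imgP/andP.
    by case=> x; rewrite -memv_preim => Ax ->; rewrite memv_img ?memvf.
  by case=> /memv_imgP[x _ ->] Ax; exists x; rewrite // -memv_preim.
have kerP : ((shiftn M n @^-1: A) :&: lker (shiftn M n) = lker (shiftn M n))%VS.
  by apply/capv_idPr; rewrite -lpreim0 lpreimS ?sub0v.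
have := dimv_sum_cap (limg (shiftn M n)) A.
have := limg_ker_dim (shiftn M n) fullv; rewrite capfv.
have := limg_ker_dim (shiftn M n) (shiftn M n @^-1: A); rewrite TP kerP; lia.
Qed.

Lemma nblocks_mark n : nblocks (mark M) fullv n = (mdim M n.+1 - mdim M n)%N.
Proof.
have := dim_shiftn_add n (mark M); have := dim_shiftn_add n.+1 (mark M).
rewrite /nblocks /mdim; lia.
Qed.

Lemma nblocks0 n : nblocks 0 fullv n = (kdim M n.+1 - kdim M n)%N.
Proof.
have := dim_shiftn_add n 0; have := dim_shiftn_add n.+1 0.
rewrite /nblocks /kdim !lpreim0; lia.
Qed.

End Subquotients.

(** * Extensions of marked operators *)

Section Extensions.

Variable K : fieldType.
Implicit Types (X Y Z : marked K) (s t : seq (bool * nat)).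

(** Short exact sequences, spelled out on elements so that they pass easily to
    direct sums. *)
Definition mext X Z Y := exists (f : 'Hom(X, Z)) (g : 'Hom(Z, Y)),
  [/\ equivariant f, equivariant g, injective f &
      forall z, g z = 0 <-> exists x, z = f x] /\
  [/\ forall y, exists z, g z = y,
      forall x, (f x \in mark Z) = (x \in mark X),
      forall z, z \in mark Z -> g z \in mark Y &
      forall y, y \in mark Y -> exists2 z, z \in mark Z & g z = y].

Lemma mext_miso X X' Z Z' Y Y' :
  miso X X' -> miso Z Z' -> miso Y Y' -> mext X Z Y -> mext X' Z' Y'.
Proof.
move=> [hX [kX [ehX hkX khX hUX kUX]]] [hZ [kZ [ehZ hkZ khZ hUZ kUZ]]].
move=> [hY [kY [ehY hkY khY hUY kUY]]].
have ekX := miso_inv_equivariant ehX hkX khX.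
have ekZ := miso_inv_equivariant ehZ hkZ khZ.
move=> [f [g [[ef eg f_inj fg] [g_surj fU gU gU']]]].
exists (hZ \o f \o kX)%VF, (hY \o g \o kZ)%VF; split; split.
- by move=> x; rewrite !comp_lfunE ekX ef ehZ.
- by move=> z; rewrite !comp_lfunE ekZ eg ehY.
- move=> x x'; rewrite !comp_lfunE => /(can_inj hkZ)/f_inj.
  exact: (can_inj khX).
- move=> z; rewrite !comp_lfunE; split=> [hg0|[x ->]].
    have /fg[x zx] : g (kZ z) = 0 by apply: (can_inj hkY); rewrite hg0 linear0.
    by exists (hX x); rewrite !comp_lfunE hkX -zx khZ.
  rewrite !comp_lfunE hkZ; have -> : g (f (kX x)) = 0 by apply/fg; exists (kX x).
  exact: linear0.
- move=> y; have [z gz] := g_surj (kY y); exists (hZ z).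
  by rewrite !comp_lfunE hkZ gz khY.
- move=> x; rewrite !comp_lfunE; apply/idP/idP => [/kUZ|/kUX].
    by rewrite hkZ fU => /hUX; rewrite khX.
  by rewrite -fU => /hUZ.
- by move=> z /kUZ/gU/hUY; rewrite !comp_lfunE.
- move=> y /kUY/gU'[z Uz gz]; exists (hZ z); first exact: hUZ.
  by rewrite !comp_lfunE hkZ gz khY.
Qed.

Lemma mext_msum X Z Y X' Z' Y' :
  mext X Z Y -> mext X' Z' Y' -> mext (msum X X') (msum Z Z') (msum Y Y').
Proof.
move=> [f [g [[ef eg f_inj fg] [g_surj fU gU gU']]]].
move=> [f' [g' [[ef' eg' f'_inj fg'] [g'_surj fU' gU1 gU1']]]].
have [F FE] : {F : 'Hom(msum X X', msum Z Z') | forall z, F z = (f z.1, f' z.2)}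
  := prod_lfun f f'.
have [G GE] : {G : 'Hom(msum Z Z', msum Y Y') | forall z, G z = (g z.1, g' z.2)}
  := prod_lfun g g'.
exists F, G; split; split.
- by move=> x; rewrite !(FE, shift_msum) /= ef ef'.
- by move=> x; rewrite !(GE, shift_msum) /= eg eg'.
- by move=> [x x'] [y y']; rewrite !FE /= => -[/f_inj-> /f'_inj->].
- move=> [z z']; rewrite GE /=; split=> [[/fg[x ->] /fg'[x' ->]]|[[x x']]].
    by exists (x, x'); rewrite FE.
  rewrite FE => -[-> ->] /=; congr pair; [apply/fg | apply/fg'].
    by exists x.
  by exists x'.
- move=> [y y']; have [z <-] := g_surj y; have [z' <-] := g'_surj y'.
  by exists (z, z'); rewrite GE.
- by move=> [x x']; rewrite !mem_mark_msum FE /= fU fU'.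
- by move=> [x x']; rewrite !mem_mark_msum GE => /andP[/gU /= -> /gU1->].
- move=> [y y']; rewrite mem_mark_msum /= => /andP[/gU'[z Uz <-] /gU1'[z' Uz' <-]].
  by exists (z, z'); rewrite ?GE // mem_mark_msum Uz.
Qed.

Lemma mext_mzeror X : mext X X (mzero K).
Proof.
exists \1%VF, 0; split; [split=> [x|x|x x'|z] | split=> [y|x|z|y]].
- by rewrite !id_lfunE.
- exact: etrans (mzero0 _) (esym (mzero0 _)).
- by rewrite !id_lfunE.
- by split=> _; [exists z; rewrite id_lfunE | apply: mzero0].
- by exists 0; rewrite (mzero0 y) linear0.
- by rewrite id_lfunE.
- by rewrite zero_lfunE mem0v.
- by exists 0; rewrite ?mem0v // (mzero0 y) linear0.
Qed.

Lemma mext_mzerol Y : mext (mzero K) Y Y.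
Proof.
exists 0, \1%VF; split; [split=> [x|x|x x' _|z] | split=> [y|x|z|y]].
- by rewrite !zero_lfunE linear0.
- by rewrite !id_lfunE.
- by rewrite (mzero0 x) (mzero0 x').
- rewrite id_lfunE; split=> [->|[x ->]]; last by rewrite zero_lfunE.
  by exists 0; rewrite linear0.
- by exists y; rewrite id_lfunE.
- by rewrite (mzero0 x) linear0 !mem0v.
- by rewrite id_lfunE.
- by exists y; rewrite ?id_lfunE.
Qed.

Lemma mext_subspaces X Z Y : mext X Z Y ->
  exists (f : 'Hom(X, Z)) (g : 'Hom(Z, Y)),
    [/\ equivariant f, equivariant g, injective f, limg g = fullv &
        lker g = limg f] /\
    (mark Z :&: limg f)%VS = (f @: mark X)%VS /\ (g @: mark Z)%VS = mark Y.
Proof.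
move=> [f [g [[ef eg f_inj fg] [g_surj fU gU gU']]]].
exists f, g; split; split=> //; apply/vspaceP.
- by move=> y; rewrite memvf; have [z <-] := g_surj y; rewrite memv_img ?memvf.
- move=> z; rewrite memv_ker.
  apply/eqP/memv_imgP => [/fg[x ->]|[x _ ->]]; first by exists x; rewrite ?memvf.
  by apply/fg; exists x.
- move=> z; rewrite memv_cap.
  apply/andP/memv_imgP => [[Uz /memv_imgP[x _ zE]]|[x Ux ->]].
    by exists x; rewrite // -fU -zE.
  by rewrite fU memv_img ?memvf.
- move=> y; apply/memv_imgP/idP => [[z /gU ? ->]//|].
  by case/gU'=> z Uz <-; exists z.
Qed.

Lemma nblocks_limg X Z (f : 'Hom(X, Z)) A B n : equivariant f -> injective f ->
  nblocks (f @: A) (f @: B) n = nblocks A B n.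
Proof.
move=> ef f_inj; have fT j : (shiftn Z j @: (f @: B) = f @: (shiftn X j @: B))%VS.
  rewrite -!limg_comp; congr (_ @: _)%VS; apply/lfunP=> x.
  by rewrite !comp_lfunE equivariantn.
by rewrite /nblocks !fT -!limgD !dimv_inj.
Qed.

Lemma nblocks_quotient Z Y (g : 'Hom(Z, Y)) A n : equivariant g ->
  limg g = fullv -> nblocks (A + lker g) fullv n = nblocks (g @: A) fullv n.
Proof.
move=> eg g_surj.
have dimE j : \dim (shiftn Z j @: fullv + (A + lker g))
    = (\dim (lker g) + \dim (shiftn Y j @: fullv + g @: A))%N.
  rewrite -(limg_ker_dim g (_ + (_ + _))) !limgD.
  have -> : (g @: lker g = 0)%VS by apply/eqP; rewrite -lkerE.
  rewrite addv0 (capv_idPr _); last by rewrite addvA addvSr.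
  congr (_ + \dim (_ + _))%N; rewrite -g_surj -!limg_comp.
  congr (_ @: _)%VS; apply/lfunP=> x; by rewrite !comp_lfunE equivariantn.
by rewrite /nblocks !dimE subnDl.
Qed.

Lemma limg_prodv (A B C D : vectType K) (h : 'Hom((A * B)%type, (C * D)%type))
    (f : 'Hom(A, C)) (g : 'Hom(B, D)) (U : {vspace A}) (V : {vspace B}) :
  (forall z, h z = (f z.1, g z.2)) ->
  (h @: prodv U V = prodv (f @: U) (g @: V))%VS.
Proof.
move=> hE; apply/vspaceP=> -[x y]; rewrite mem_prodv; apply/memv_imgP/andP => /=.
  by case=> z; rewrite mem_prodv hE => /andP[Uz Vz] [-> ->]; rewrite !memv_img.
case=> /memv_imgP[a Ua ->] /memv_imgP[b Vb ->].
by exists (a, b); rewrite ?mem_prodv ?hE //= Ua.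
Qed.

(** A submodule with [k] generators of the largest possible dimension, when
    [t] is sorted. *)
Fixpoint topv k t {struct t} : {vspace (Nsum K t)} :=
  match t return {vspace (Nsum K t)} with
  | [::] => 0%VS
  | e :: t' => if k is k'.+1 then
      prodv (fullv : {vspace (cyc K e)}) (topv k' t') else 0%VS
  end.

Arguments topv : simpl never.

Lemma topvS k e t :
  topv k.+1 (e :: t) = prodv (fullv : {vspace (cyc K e)}) (topv k t).
Proof. by []. Qed.

Lemma topv0 t : topv 0 t = 0%VS.
Proof. by case: t. Qed.

Lemma topv_nil k : topv k [::] = 0%VS.
Proof. by []. Qed.

Lemma limg_shift_prodv X Y (U : {vspace X}) (V : {vspace Y}) :
  (shift (msum X Y) @: prodv U V = prodv (shift X @: U) (shift Y @: V))%VS.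
Proof. by apply: limg_prodv => z; apply: shift_msum. Qed.

Lemma stable_topv k t : stable (topv k t).
Proof.
elim: t k => [|e t IH] [|k]; rewrite ?topv_nil ?topv0; try exact: stable0.
rewrite topvS /stable limg_shift_prodv; apply/subvP=> -[x y] /=.
rewrite !mem_prodv memvf /= => /andP[_ Vy]; exact: (subvP (IH k)).
Qed.

Lemma dim_topv k t : \dim (topv k t) = top k (betas t).
Proof.
elim: t k => [|e t IH] [|k];
  rewrite ?top0 ?top_nil ?topv_nil ?topv0 ?dimv0 //.
by rewrite topvS dim_prodv dim_cyc IH.
Qed.

Lemma gen_topv k t :
  (\dim (topv k t) <= \dim (shift (Nsum K t) @: topv k t) + k)%N.
Proof.
elim: t k => [|e t IH] [|k]; rewrite ?topv_nil ?topv0 ?dimv0 //.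
rewrite topvS (limg_shift_prodv (X := cyc K e) (Y := Nsum K t)).
rewrite !(dim_prodv (A := cyc K e) (B := Nsum K t)).
have := IH k; have := limg_ker_dim (shift (cyc K e)) fullv.
have := kdim_cyc K e 1; rewrite /kdim capfv.
have -> : shiftn (cyc K e) 1 = shift (cyc K e) by apply: comp_lfun1r.
rewrite dim_cyc; lia.
Qed.

Lemma dim_mark_cyc (e : bool * nat) :
  (e.1 <= e.2)%N -> \dim (mark (cyc K e)) = e.1.
Proof.
move=> e_ok; have := mdim_cyc K 0 e_ok; rewrite min0n addn0 => mdimE.
rewrite -[RHS]mdimE.
congr (\dim _); apply/vspaceP=> x; by rewrite -memv_preim shiftn0.
Qed.

Lemma dim_topv_mark k t : (forall e, e \in t -> 0 < e.2)%N ->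
  \dim (topv k t :&: mark (Nsum K t)) = nmarks (take k t).
Proof.
rewrite /nmarks; elim: t k => [|e t IH] [|k] pos;
  rewrite ?topv_nil ?topv0 ?cap0v ?dimv0 ?big_nil //= big_cons.
have e_ok : (e.1 <= e.2)%N by have := pos e (mem_head _ _); case: e.1.
have capE : (topv k.+1 (e :: t) :&: mark (msum (cyc K e) (Nsum K t)))%VS
    = prodv (mark (cyc K e)) (topv k t :&: mark (Nsum K t)).
  apply/vspaceP=> -[x y]; rewrite memv_cap [X in _ && X]mem_mark_msum !mem_prodv.
  by rewrite memv_cap memvf /= andbCA.
rewrite capE dim_prodv dim_mark_cyc // IH // => e' et.
by apply: pos; rewrite inE et orbT.
Qed.

Lemma dim_Nsum s : \dim {: Nsum K s} = sumn (betas s).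
Proof.
elim: s => [|e s IH]; last first.
  rewrite /= -IH -(dim_cyc K e) -dim_prodv; congr (\dim _).
  by apply/vspaceP=> z; rewrite mem_prodv !memvf.
by apply/eqP; rewrite dimv_eq0 -subv0; apply/subvP=> x _; rewrite (mzero0 x) mem0v.
Qed.

Lemma dim_mark_Nsum s : (forall e, e \in s -> 0 < e.2)%N ->
  \dim (mark (Nsum K s)) = nmarks s.
Proof.
move=> pos; have := mdim_tsum K 0 pos; rewrite tsum0 addn0 => <-.
congr (\dim _); apply/vspaceP=> x; by rewrite -memv_preim shiftn0.
Qed.

Lemma nblocks_betas s n :
  nblocks 0 (fullv : {vspace (Nsum K s)}) n = count (ltn n) (betas s).
Proof. by rewrite nblocks0 !kdim_tsum tsumS addKn. Qed.

Lemma nblocks_gammas s n : (forall e, e \in s -> 0 < e.2)%N ->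
  nblocks (mark (Nsum K s)) fullv n = count (ltn n) (gammas s).
Proof. by move=> pos; rewrite nblocks_mark !mdim_tsum // tsumS addnA addKn. Qed.

Section Bounds.

Variables sX sY t : seq (bool * nat).
Hypotheses (std_X : standard sX) (std_Y : standard sY) (std_t : standard t).
Hypothesis extZ : mext (Nsum K sX) (Nsum K t) (Nsum K sY).

Let pos_X := standard_pos std_X.
Let pos_Y := standard_pos std_Y.
Let pos_t := standard_pos std_t.

Local Notation Z := (Nsum K t).

Lemma mext_dims :
  sumn (betas t) = (sumn (betas sX) + sumn (betas sY))%N /\
  nmarks t = (nmarks sX + nmarks sY)%N.
Proof.
have [f [g [[_ _ f_inj limg_g kerg] [UfE gUE]]]] := mext_subspaces extZ.
split.
  by rewrite -!dim_Nsum -(limg_ker_dim g) capfv kerg limg_g dimv_inj.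
rewrite -!dim_mark_Nsum // -(limg_ker_dim g) kerg gUE UfE.
by rewrite dimv_inj.
Qed.

(** This is [filtration_bound] for the largest submodule with [k] generators of
    [Z], resp. of its quotient by the mark. In the third bound the first piece
    lies in [X + U], where [U] is the mark of [Z]; apart from the blocks of [X],
    this has one block of size 1 for each mark of [Y]. *)
Lemma mext_bounds k :
  [/\ top k (gammas t) <= top k (gammas sX) + top k (gammas sY),
      top k (betas t) <= top k (betas sX) + top k (betas sY) &
      top k (betas t) + minn k (size sX) <=
        top k (betas sX) + top k (gammas sY)
        + minn k (size sX + nmarks sY)]%N.
Proof.
have [_ dimU] := mext_dims.
have [f [g [[ef eg f_inj limg_g kerg] [UfE gUE]]]] := mext_subspaces extZ.
have [[N0 TN0] TU] := regular_Nsum K t.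
pose N := (N0 + (sumn (betas sX) + sumn (betas sY))).+1.
have TN z : shiftn Z N z = 0.
  by apply: (@shiftn_eq0 _ Z N0 _ _ _ (TN0 z)); rewrite /N; lia.
have NX : (sumn (betas sX) <= N)%N by rewrite /N; lia.
have NY : (sumn (betas sY) <= N)%N by rewrite /N; lia.
have sU : stable (mark Z).
  by apply/stableP=> u /TU->; apply: mem0v.
have sf : stable (limg f).
  apply/stableP=> _ /memv_imgP[x _ ->]; rewrite -ef; apply: memv_img.
  exact: memvf.
have sV := stable_topv k t.
have genV := gen_topv k t.
have genV0 : (\dim (topv k t) <= \dim (shift Z @: topv k t + 0) + k)%N.
  by rewrite addv0.
have TUadd (V : {vspace Z}) : (shift Z @: (V + mark Z) + mark Z
    = shift Z @: V + mark Z)%VS.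
  rewrite limgD; have -> : (shift Z @: mark Z = 0)%VS.
    by apply/eqP; rewrite -lkerE; apply/subvP=> u /TU; rewrite memv_ker => ->.
  by rewrite addv0.
have nb_quot A n : nblocks (A + limg f) fullv n = nblocks (g @: A) fullv n.
  by rewrite -kerg nblocks_quotient.
have nb_sub n : nblocks (0 :&: limg f) (limg f) n = count (ltn n) (betas sX).
  by rewrite cap0v -(limg0 f) nblocks_limg // nblocks_betas.
split.
- have := @filtration_bound K Z (mark Z) (limg f) (topv k t + mark Z) k N
    sU sf (stable_add sV sU) TN (addvSr _ _).
  rewrite TUadd UfE.
  under [X in (_ + X + _)%N]eq_bigr do rewrite nblocks_limg // nblocks_gammas //.
  under [X in (_ + _ + X)%N]eq_bigr do rewrite nb_quot gUE nblocks_gammas //.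
  rewrite (top_count_gammas k std_X NX) (top_count_gammas k std_Y NY).
  have gen_k : (\dim (topv k t + mark Z)
      <= \dim (shift Z @: topv k t + mark Z) + k)%N.
    by have := dim_quotient_le (mark Z) sV; move: genV; lia.
  move=> /(_ gen_k); have := dimv_sum_cap (topv k t) (mark Z).
  rewrite dim_topv_mark // dim_topv top_betas //; lia.
- have := filtration_bound (stable0 Z) sf sV TN (sub0v _) genV0.
  under [X in (_ + X + _)%N]eq_bigr do rewrite nb_sub.
  under [X in (_ + _ + X)%N]eq_bigr do rewrite nb_quot limg0 nblocks_betas.
  rewrite (top_count_betas k std_X NX) (top_count_betas k std_Y NY).
  by rewrite dimv0 add0n dim_topv.
- have := filtration_bound (stable0 Z) (stable_add sU sf) sV TN (sub0v _) genV0.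
  rewrite cap0v dimv0 add0n add0v.
  under [X in (_ <= _ + X)%N -> _]eq_bigr do rewrite nb_quot gUE nblocks_gammas //.
  rewrite (top_count_gammas k std_Y NY) dim_topv.
  (* The number of all blocks of [X + U], and of those of size at least 2. *)
  have nb0 : nblocks 0 (mark Z + limg f) 0 = (size sX + nmarks sY)%N.
    rewrite /nblocks !addv0 lim1g limg_shiftnS lim1g limgD.
    have -> : (shift Z @: mark Z = 0)%VS.
      by apply/eqP; rewrite -lkerE; apply/subvP=> u /TU; rewrite memv_ker => ->.
    rewrite add0v.
    have : nblocks 0 (limg f) 0 = size sX.
      rewrite -[X in nblocks X _](cap0v (limg f)) nb_sub -[RHS](size_map snd).
      by apply/eqP; rewrite -all_count; apply/allP=> _ /mapP[e /pos_X ? ->].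
    rewrite /nblocks !addv0 lim1g limg_shiftnS lim1g.
    have := dimv_sum_cap (mark Z) (limg f); rewrite UfE dimv_inj // !dim_mark_Nsum //.
    have := dimvS sf; lia.
  have nbS n : nblocks 0 (mark Z + limg f) n.+1 = count (ltn n.+1) (betas sX).
    rewrite -nb_sub cap0v /nblocks !addv0.
    have TnU j : (shiftn Z j.+1 @: (mark Z + limg f) = shiftn Z j.+1 @: limg f)%VS.
      rewrite limgD; have -> : (shiftn Z j.+1 @: mark Z = 0)%VS.
        apply/eqP; rewrite -lkerE; apply/subvP=> u /TU Tu.
        by rewrite memv_ker shiftnS Tu linear0.
      by rewrite add0v.
    by rewrite !TnU.
  have := top_count_betas k std_X NX; rewrite /N !big_ord_recl nb0.
  under eq_bigr do rewrite lift0.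
  under [X in (_ <= _ + X + _)%N -> _]eq_bigr do rewrite lift0 nbS.
  have -> : count (ltn 0) (betas sX) = size sX.
    rewrite -[RHS](size_map snd).
    by apply/eqP; rewrite -all_count; apply/allP=> _ /mapP[e /pos_X ? ->].
  move=> <-; lia.
Qed.

End Bounds.

End Extensions.

(** * Elementary extensions *)

Section Blocks.

Variable K : fieldType.
Implicit Types (X Y Z M : marked K) (e : bool * nat).

Lemma cyc_span e M (f : 'Hom(cyc K e, M)) (W : {vspace M}) :
  equivariant f -> stable W -> f (gen K e) \in W -> forall x, f x \in W.
Proof.
move=> ef /stableP sW Wg x; rewrite (gen_expand x) linear_sum memv_suml // => i _.
rewrite linearZ memvZ //= (equivariantn _ _ ef).
by elim: (i : nat) => [|j IH]; rewrite ?shiftn0 // shiftSn sW.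
Qed.

Lemma exact_of_dim X Z Y (f : 'Hom(X, Z)) (g : 'Hom(Z, Y)) :
    injective f -> limg g = fullv -> (forall x, g (f x) = 0) ->
    \dim {: Z} = (\dim {: X} + \dim {: Y})%N ->
  forall z, g z = 0 <-> exists x, z = f x.
Proof.
move=> f_inj g_surj gf dimZ z; have sub : (limg f <= lker g)%VS.
  by apply/subvP=> _ /memv_imgP[x _ ->]; rewrite memv_ker gf.
have kerE : lker g = limg f.
  apply/eqP; rewrite eq_sym eqEdim sub dimv_inj //.
  have := limg_ker_dim g fullv; rewrite capfv g_surj dimZ; lia.
split=> [gz|[x ->]]; last exact: gf.
have /memv_imgP[x _ ->] : z \in limg f by rewrite -kerE memv_ker gz.
by exists x.
Qed.

Lemma dim_msum X Y : \dim {: msum X Y} = (\dim {: X} + \dim {: Y})%N.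
Proof.
rewrite -dim_prodv; congr (\dim _); apply/vspaceP=> z.
by rewrite mem_prodv !memvf.
Qed.

Lemma limg_full M Y (g : 'Hom(M, Y)) : limg g = fullv ->
  forall y, exists z, g z = y.
Proof.
move=> g_surj y; have /memv_imgP[z _ ->] : y \in limg g by rewrite g_surj memvf.
by exists z.
Qed.

Lemma stable_limg M Y (g : 'Hom(M, Y)) : equivariant g -> stable (limg g).
Proof.
move=> eg; apply/stableP=> _ /memv_imgP[z _ ->].
by rewrite -eg memv_img ?memvf.
Qed.

(** The submodule is the image of the [c]-th shift on the long block. It has
    the same socle as the long block, which is therefore marked or not as that
    of the submodule. *)
Lemma mext_concat b m c : (0 < m)%N ->
  mext (cyc K (b, m)) (cyc K (b, (m + c)%N)) (cyc K (false, c)).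
Proof.
move=> m_gt0; set X := cyc K _; set Z := cyc K _; set Y := cyc K _.
pose z0 : Z := gen K _; pose y0 : Y := gen K _.
have [|f [ef fx]] := @cyc_hom K (b, m) Z (shiftn Z c z0).
  by rewrite -shiftnD (cyc_order (e := (b, (m + c)%N))).
have [|g [eg gz]] := @cyc_hom K (b, (m + c)%N) Y y0.
  by rewrite shiftnD (cyc_order (e := (false, c))) linear0.
have f_inj : injective f.
  apply: (cyc_hom_inj ef m_gt0); rewrite fx -shiftnD /=.
  have -> : (m.-1 + c = (m + c).-1)%N by lia.
  by apply: (@gen_socle_neq0 K (b, (m + c)%N)); rewrite /=; lia.
have gf x : g (f x) = 0.
  have gf0 : (g \o f)%VF = 0.
    apply: cyc_hom_eq0; first by move=> u; rewrite !comp_lfunE ef eg.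
    rewrite comp_lfunE fx (equivariantn _ _ eg) gz.
    exact: (cyc_order (e := (false, c))).
  by rewrite -comp_lfunE gf0 zero_lfunE.
have g_surj : limg g = fullv.
  apply/vspaceP=> y; rewrite memvf -[y]id_lfunE.
  apply: (@cyc_span (false, c) Y \1%VF) => [u||].
  - by rewrite !id_lfunE.
  - exact: stable_limg.
  - by rewrite id_lfunE -[gen _ _]gz memv_img ?memvf.
exists f, g; split; split=> //.
- by apply: exact_of_dim => //; rewrite !dim_cyc.
- exact: limg_full.
- move=> x; rewrite !mem_mark_cyc -ef -!(inj_eq f_inj) !linear0 //.
- move=> z; rewrite !mem_mark_cyc => /orP[/eqP->|/andP[_ /eqP/cyc_ker[a ->]]].
    by rewrite linear0 eqxx.
  rewrite linearZ /= (equivariantn _ _ eg) gz.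
  rewrite (@shiftn_eq0 _ Y c _ _ _ (cyc_order _)) ?scaler0 ?eqxx //; lia.
- move=> y; rewrite mem_mark_cyc orbF => /eqP->.
  by exists 0; rewrite ?mem0v ?linear0.
Qed.

(** A marked block of size [c] next to a shorter unmarked one of size [d]: the
    concatenated block loses one box, and the mark moves to the shorter block,
    which gains one box. The generator [x0] of the submodule is sent to
    [T^(c-1) z1 - T^d z2]. In the quotient [z1] becomes the first generator
    [y1], and [z2] becomes [T^(c-1-d) y1 + y2], so that the marked socle of the
    second block, spanned by [T^d z2], is mapped onto that of the first block
    of the quotient. For [d = 0] this creates a marked block of size 1. *)
Lemma mext_exchange b m c d : (0 < m)%N -> (d < c)%N ->
  mext (cyc K (b, m))
       (msum (cyc K (b, (m + c.-1)%N)) (cyc K (true, d.+1)))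
       (msum (cyc K (true, c)) (cyc K (false, d))).
Proof.
move=> m_gt0 d_c; set X := cyc K _; set Z1 := cyc K (b, _).
set Z2 := cyc K (true, d.+1); set Y1 := cyc K (true, c).
set Y2 := cyc K (false, d).
pose x0 : X := gen K _; pose z1 : Z1 := gen K _; pose z2 : Z2 := gen K _.
pose y1 : Y1 := gen K _; pose y2 : Y2 := gen K _.
have oZ1 n (z : Z1) : (m + c.-1 <= n)%N -> shiftn Z1 n z = 0.
  by move=> le_n; apply: shiftn_eq0 le_n (cyc_order z).
have oZ2 n (z : Z2) : (d.+1 <= n)%N -> shiftn Z2 n z = 0.
  by move=> le_n; apply: shiftn_eq0 le_n (cyc_order z).
have oY1 n (y : Y1) : (c <= n)%N -> shiftn Y1 n y = 0.
  by move=> le_n; apply: shiftn_eq0 le_n (cyc_order y).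
have oY2 n (y : Y2) : (d <= n)%N -> shiftn Y2 n y = 0.
  by move=> le_n; apply: shiftn_eq0 le_n (cyc_order y).
have [|f1 [ef1 f1x]] := @cyc_hom K (b, m) Z1 (shiftn Z1 c.-1 z1).
  by rewrite -shiftnD oZ1.
have [|f2 [ef2 f2x]] := @cyc_hom K (b, m) Z2 (- shiftn Z2 d z2).
  by rewrite linearN /= -shiftnD oZ2 ?oppr0 //=; lia.
have [f fE] : {f : 'Hom(X, msum Z1 Z2) | forall x, f x = (f1 x, f2 x)} :=
  prod_lfun1 f1 f2.
have [|g1 [eg1 g1z]] := @cyc_hom K (b, (m + c.-1)%N) (msum Y1 Y2) (y1, 0).
  by rewrite shiftn_msum /= linear0 oY1 //; lia.
have [|g2 [eg2 g2z]] := @cyc_hom K (true, d.+1) (msum Y1 Y2)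
    (shiftn Y1 (c.-1 - d)%N y1, y2).
  by rewrite shiftn_msum /= -shiftnD oY1 ?oY2 //; lia.
have [g gE] : {g : 'Hom(msum Z1 Z2, msum Y1 Y2) | forall z, g z = g1 z.1 + g2 z.2}
  := pair_lfun g1 g2.
have ef : equivariant f by move=> x; rewrite !fE shift_msum ef1 ef2.
have eg : equivariant g by move=> z; rewrite !gE shift_msum eg1 eg2 linearD.
have f1_inj : injective f1.
  apply: (cyc_hom_inj ef1 m_gt0); rewrite f1x -shiftnD /=.
  have -> : (m.-1 + c.-1 = (m + c.-1).-1)%N by lia.
  by apply: (@gen_socle_neq0 K (b, (m + c.-1)%N)); rewrite /=; lia.
have f_inj : injective f by move=> x x'; rewrite !fE => -[/f1_inj].
have gT2 : g2 (shiftn Z2 d z2) = (shiftn Y1 c.-1 y1, 0).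
  rewrite (equivariantn _ _ eg2) g2z shiftn_msum /= -shiftnD oY2 //.
  by have -> : (d + (c.-1 - d) = c.-1)%N by lia.
have gf x : g (f x) = 0.
  have gf0 : (g \o f)%VF = 0.
    apply: (@cyc_hom_eq0 K (b, m)); first by move=> u; rewrite !comp_lfunE ef eg.
    rewrite comp_lfunE fE gE /= f1x f2x linearN /= gT2 (equivariantn _ _ eg1) g1z.
    by rewrite shiftn_msum /= linear0 subrr.
  by rewrite -comp_lfunE gf0 zero_lfunE.
have sg := stable_limg eg.
have inl_g u : (u, 0) \in limg g.
  rewrite -inlvE; apply: (@cyc_span (true, c) (msum Y1 Y2) (inlv Y1 Y2)) => //.
    by move=> v; rewrite !inlvE shift_msum /= linear0.
  have -> : inlv Y1 Y2 (gen K (true, c)) = g (z1, 0).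
    by rewrite gE /= g1z linear0 addr0 inlvE.
  by rewrite memv_img ?memvf.
have inr_g v : (0, v) \in limg g.
  rewrite -inrvE; apply: (@cyc_span (false, d) (msum Y1 Y2) (inrv Y1 Y2)) => //.
    by move=> w; rewrite !inrvE shift_msum /= linear0.
  have -> : inrv Y1 Y2 (gen K (false, d))
      = g (0, z2) - (shiftn Y1 (c.-1 - d)%N y1, 0) :> msum Y1 Y2.
    rewrite gE /= linear0 add0r g2z inrvE; congr pair => /=.
      by rewrite subrr.
    by rewrite subr0.
  by rewrite memvB ?inl_g ?memv_img ?memvf.
have g_surj : limg g = fullv.
  apply/vspaceP=> -[u v]; rewrite memvf.
  have -> : (u, v) = (u, 0) + (0, v) :> msum Y1 Y2.
    by congr pair; rewrite /= ?addr0 ?add0r.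
  by rewrite memvD.
exists f, g; split; split=> //.
- apply: exact_of_dim => //; rewrite !dim_msum !dim_cyc /=; lia.
- exact: limg_full.
- move=> x; rewrite mem_mark_msum fE !mem_mark_cyc /= -ef1 -ef2.
  rewrite -(linear0 f1) !(inj_eq f1_inj) andb_idr //.
  by case/orP=> [/eqP->|/andP[_ /eqP->]]; rewrite !linear0 eqxx ?orbT.
- move=> [u v]; rewrite !mem_mark_msum => /andP[Uu Uv].
  have Tu : shift Z1 u = 0 by case: (regular_cyc K (b, (m + c.-1)%N)) => _; apply.
  have Tv : shift Z2 v = 0 by case: (regular_cyc K (true, d.+1)) => _; apply.
  have Tg : shift (msum Y1 Y2) (g (u, v)) = 0.
    by rewrite -eg shift_msum /= Tu Tv [X in g X](_ : _ = 0) ?linear0.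
  have g_2 : (g (u, v)).2 = 0.
    have [a ->] := cyc_ker Tv; rewrite gE /= linearZ /= gT2 /= scaler0 addr0.
    have [a' ->] := cyc_ker Tu; rewrite linearZ /= (equivariantn _ _ eg1) g1z.
    by rewrite shiftn_msum /= linear0 scaler0.
  rewrite !mem_mark_cyc g_2 eqxx andbT /=.
  by move: Tg; rewrite shift_msum => -[-> _]; rewrite eqxx orbT.
- move=> [u v]; rewrite mem_mark_msum !mem_mark_cyc orbF => /andP[Uu /eqP v0].
  have {v0} -> : v = 0 by [].
  have [a uE] : exists a, u = a *: shiftn Y1 c.-1 y1.
    case/orP: Uu => /eqP; last exact: (@cyc_ker K (true, c)).
    by move=> u0; exists 0; rewrite scale0r.
  exists (0, a *: shiftn Z2 d z2).
    have Ts : shift Z2 (a *: shiftn Z2 d z2) = 0.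
      by rewrite linearZ /= -shiftSn oZ2 // scaler0.
    by rewrite mem_mark_msum mem0v mem_mark_cyc Ts eqxx orbT.
  rewrite gE /= linear0 add0r linearZ /= gT2 uE.
  by congr pair; rewrite /= ?scaler0.
Qed.

Lemma miso_msumA X Y Z : regular X -> regular Y -> regular Z ->
  miso (msum (msum X Y) Z) (msum X (msum Y Z)).
Proof.
move=> rX rY rZ; apply: miso_of_dims => [||n|n].
- by do 2!apply: regular_msum => //.
- by do 2!apply: regular_msum => //.
- by rewrite !kdim_msum addnA.
- by rewrite !mdim_msum addnA.
Qed.

Lemma miso_Nsum_perm (s t : seq (bool * nat)) k :
    all (fun e => e.1 <= e.2)%N s -> perm_eq (s ++ nseq k (false, 0%N)) t ->
  miso (Nsum K s) (Nsum K t).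
Proof.
move=> s_ok st; have t_ok : all (fun e => e.1 <= e.2)%N t.
  rewrite -(perm_all _ st) all_cat s_ok /=; apply/allP=> e.
  by rewrite mem_nseq => /andP[_ /eqP->].
apply: miso_of_dims => [||n|n]; try exact: regular_Nsum.
  rewrite !kdim_Nsum -(perm_big _ st) big_cat /= big_nseq.
  rewrite [X in (_ + X)%N](_ : _ = 0%N) ?addn0 //.
  by elim: (k) => //= j ->; rewrite minn0.
rewrite !mdim_Nsum // -(perm_big _ st) big_cat /= big_nseq.
  rewrite [X in (_ + X)%N](_ : _ = 0%N) ?addn0 //.
by elim: (k) => //= j ->; rewrite minn0.
Qed.

End Blocks.

(** * The algorithm on lists of blocks *)

Section Star.

Local Open Scope nat_scope.
Implicit Types (s sX sY : seq (bool * nat)) (n k : nat).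

(** The algorithm as a recursion on the blocks of [X] and [Y]; [n] is its
    counter, the number of marks of [Y] that have not been placed yet. *)
Fixpoint star n sX sY {struct sY} : seq (bool * nat) :=
  match sX, sY with
  | (b, m) :: sX', (b', c) :: sY' => (b, m + (c - b')) :: star (n + b') sX' sY'
  | [::], (b', c) :: sY' =>
      let d := ~~ b' && (0 < n) in (b' || d, c + d) :: star (n - d) [::] sY'
  | _, [::] => sX ++ nseq n (true, 1)
  end.

Lemma star_pos n sX sY : (forall e, e \in sX -> 0 < e.2) ->
    (forall e, e \in sY -> 0 < e.2) ->
  forall e, e \in star n sX sY -> 0 < e.2.
Proof.
elim: sY sX n => [|[b' c] sY IH] [|[b m] sX] n posX posY e /=.
- by rewrite mem_nseq => /andP[_ /eqP->].
- rewrite inE mem_cat mem_nseq orbA => /orP[|/andP[_ /eqP->]//].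
  by rewrite -in_cons => /posX.
- have posY' e' : e' \in sY -> 0 < e'.2 by move=> eY; rewrite posY // inE eY orbT.
  rewrite inE => /orP[/eqP->|/IH->//] /=.
  by have /= := posY _ (mem_head _ _); lia.
- have posY' e' : e' \in sY -> 0 < e'.2 by move=> eY; rewrite posY // inE eY orbT.
  have posX' e' : e' \in sX -> 0 < e'.2 by move=> eX; rewrite posX // inE eX orbT.
  rewrite inE => /orP[/eqP->|/IH->//] /=.
  by have /= := posX _ (mem_head _ _); lia.
Qed.

Lemma top_nseq k n x : top k (nseq n x) = minn k n * x.
Proof.
elim: n k => [|n IH] [|k]; rewrite ?top_nil ?top0 ?minn0 ?min0n //.
by rewrite top_cons IH minnSS mulSn.
Qed.

Lemma top_cat_nseq k l n x :
  top k (l ++ nseq n x) = top k l + minn (k - size l) n * x.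
Proof.
elim: l k => [|y l IH] [|k] /=; rewrite ?top_nil ?top0 ?min0n //.
  by rewrite subn0 add0n top_nseq.
by rewrite !top_cons IH subSS addnA.
Qed.

Lemma nmarks_cons e s : nmarks (e :: s) = e.1 + nmarks s.
Proof. exact: big_cons. Qed.

Lemma nmarks_nil : nmarks [::] = 0.
Proof. exact: big_nil. Qed.

Lemma nmarks_le s : nmarks s <= size s.
Proof. by elim: s => [|[b m] s IH]; rewrite ?nmarks_nil // nmarks_cons /=; lia. Qed.

Lemma top_gammas_star n sX sY k : (forall e, e \in sX -> 0 < e.2) ->
    (forall e, e \in sY -> 0 < e.2) ->
  top k (gammas (star n sX sY)) = top k (gammas sX) + top k (gammas sY).
Proof.
elim: sY sX n k => [|[b' c] sY IH] sX n k posX posY.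
  have -> : star n sX [::] = sX ++ nseq n (true, 1) by case: sX {posX} => [|[]].
  rewrite /gammas map_cat map_nseq -/(gammas _) top_cat_nseq top_nil.
  by rewrite muln0 addn0.
have posY' e' : e' \in sY -> 0 < e'.2 by move=> eY; rewrite posY // inE eY orbT.
have /= c_gt0 := posY _ (mem_head _ _).
case: k => [|k]; first by rewrite !top0.
case: sX posX => [|[b m] sX] posX.
  by rewrite /= !top_cons IH // !top_nil; case: b' {posY} => /=; lia.
have posX' e' : e' \in sX -> 0 < e'.2 by move=> eX; rewrite posX // inE eX orbT.
have /= m_gt0 := posX _ (mem_head _ _).
by rewrite /= !top_cons IH //; lia.
Qed.

(** The last summand counts the marks served up to position [k]. There are
    [n + nmarks (take k sY)] of them to serve, only the positions from
    [size sX] on can serve one, and since at most one mark arrives at each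
    position, no position is ever wasted while a mark is waiting. *)
Lemma top_betas_star n sX sY k : (forall e, e \in sX -> 0 < e.2) ->
    (forall e, e \in sY -> 0 < e.2) ->
  top k (betas (star n sX sY)) = top k (betas sX) + top k (gammas sY)
    + minn (k - size sX) (n + nmarks (take k sY)).
Proof.
elim: sY sX n k => [|[b' c] sY IH] sX n k posX posY.
  have -> : star n sX [::] = sX ++ nseq n (true, 1) by case: sX {posX} => [|[]].
  rewrite /betas map_cat map_nseq -/(betas _) top_cat_nseq top_nil size_map.
  by rewrite nmarks_nil muln1 !addn0.
have posY' e' : e' \in sY -> 0 < e'.2 by move=> eY; rewrite posY // inE eY orbT.
have /= c_gt0 := posY _ (mem_head _ _).
case: k => [|k]; first by rewrite !top0 sub0n min0n.
case: sX posX => [|[b m] sX] posX.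
  rewrite /= !top_cons IH // !top_nil nmarks_cons /=.

  have := nmarks_le (take k sY); rewrite size_take_min; case: b' c_gt0 {posY} => /=; lia.
have posX' e' : e' \in sX -> 0 < e'.2 by move=> eX; rewrite posX // inE eX orbT.
have /= m_gt0 := posX _ (mem_head _ _).
rewrite /= !top_cons IH // nmarks_cons /=; lia.
Qed.

Lemma topS k l : top k.+1 l = top k l + nth 0 l k.
Proof.
elim: l k => [|x l IH] [|k]; rewrite ?top_nil ?top0 ?top_cons ?top0 ?addn0 //.
by rewrite IH addnA.
Qed.

Lemma nth_gammas_star n sX sY i : (forall e, e \in sX -> 0 < e.2) ->
    (forall e, e \in sY -> 0 < e.2) ->
  nth 0 (gammas (star n sX sY)) i = nth 0 (gammas sX) i + nth 0 (gammas sY) i.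
Proof.
move=> posX posY; have := top_gammas_star n i.+1 posX posY.
by rewrite !topS top_gammas_star //; lia.
Qed.

Lemma nmarks_takeS k s :
  nmarks (take k.+1 s) = nmarks (take k s) + (nth (false, 0) s k).1.
Proof.
elim: s k => [|e s IH] [|k]; rewrite ?nmarks_nil //=.
  by rewrite take0 !nmarks_cons nmarks_nil addn0.
by rewrite !nmarks_cons IH addnA.
Qed.

Lemma nth_geq l i : sorted geq l -> nth 0 l i.+1 <= nth 0 l i.
Proof.
move=> sl; case: (ltnP i.+1 (size l)) => [i_lt|i_ge]; last by rewrite nth_default.
by have /sortedP/(_ i i_lt) := sl; apply.
Qed.

Lemma nth_betas_gammas s i : (forall e, e \in s -> 0 < e.2) ->
  nth 0 (betas s) i = nth 0 (gammas s) i + (nth (false, 0) s i).1.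
Proof.
move=> pos; case: (ltnP i (size s)) => [i_lt|i_ge].
  rewrite !(nth_map (false, 0)) //; have := pos _ (mem_nth (false, 0) i_lt).
  by case: (nth _ _ _) => [[] m] /=; lia.
by rewrite !nth_default ?size_map.
Qed.

(** Beyond the blocks of [X] the parts of gamma come from [Y], and a position
    that serves no mark can be followed by one that does only if the latter is
    marked in [Y]; then the part of gamma has dropped, since that of beta has
    not grown. *)
Lemma standard_star sX sY :
  standard sX -> standard sY -> standard (star 0 sX sY).
Proof.
move=> std_X std_Y; have posX := standard_pos std_X; have posY := standard_pos std_Y.
have posZ := @star_pos 0 _ _ posX posY.
rewrite /standard andbC; apply/andP; split; first exact/allP.
have nthb i : nth 0 (betas (star 0 sX sY)) i
    + minn (i - size sX) (nmarks (take i sY)) =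
    nth 0 (betas sX) i + nth 0 (gammas sY) i
    + minn (i.+1 - size sX) (nmarks (take i.+1 sY)).
  have := top_betas_star 0 i.+1 posX posY; rewrite !topS top_betas_star //; lia.
apply/(sortedP (false, 0)) => i i_lt; rewrite /dominates.
have i_lt' := ltnW i_lt.
have nth_b j : j < size (star 0 sX sY) ->
    (nth (false, 0) (star 0 sX sY) j).2 = nth 0 (betas (star 0 sX sY)) j.
  by move=> j_lt; rewrite (nth_map (false, 0)).
have nth_g j : j < size (star 0 sX sY) ->
    (nth (false, 0) (star 0 sX sY) j).2 - (nth (false, 0) (star 0 sX sY) j).1
    = nth 0 (gammas (star 0 sX sY)) j.
  by move=> j_lt; rewrite (nth_map (false, 0)).
rewrite !nth_g // !nth_b // !nth_gammas_star //.
have gX := nth_geq i (standard_gammas std_X).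
have gY := nth_geq i (standard_gammas std_Y).
have bX := nth_geq i (standard_betas std_X).
have bY := nth_geq i (standard_betas std_Y).
rewrite leq_add // andbT.
have := nthb i; have := nthb i.+1; move: bY; rewrite !(nth_betas_gammas _ posY).
rewrite !nmarks_takeS; case: (ltnP i.+1 (size sX)) => [|iX]; first lia.
have -> : nth 0 (betas sX) i.+1 = 0 by rewrite nth_default ?size_map.
case: (ltnP i (size sX)) => [iX'|iX']; last first.
  have -> : nth 0 (betas sX) i = 0 by rewrite nth_default ?size_map.
  lia.
have : 0 < nth 0 (betas sX) i.
  by rewrite (nth_map (false, 0)) // posX // mem_nth.
lia.
Qed.

Lemma nmarks_cat s t : nmarks (s ++ t) = nmarks s + nmarks t.
Proof. exact: big_cat. Qed.

End Star.

(** * The algorithm computes the generic extension *)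

Section StarExtension.

Variable K : fieldType.
Implicit Types (s sX sY R S : seq (bool * nat)) (n k : nat).

Lemma perm_cons_cat (T : eqType) (x : T) (s l r : seq T) :
  perm_eq s (l ++ r) -> perm_eq (x :: s) (l ++ x :: r).
Proof. by move=> slr; rewrite perm_sym -cat1s perm_catCA perm_cons perm_sym. Qed.

(** The [n] waiting marks will be absorbed by unmarked blocks of [Y], whose
    sizes are collected in [J]; the size 0 stands for the creation of a new
    block. Leaving these out, the rest is already a direct sum of elementary
    extensions. A marked block facing a block of [X] puts one more mark into
    the queue, and [mext_exchange] applies to it and to the block that will
    serve this mark. *)
Lemma star_matching sX sY n :
    (forall e, e \in sX -> 0 < e.2)%N -> (forall e, e \in sY -> 0 < e.2)%N ->
    sorted geq (gammas sY) ->
  exists (J : seq nat) R S k,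
    [/\ size J = n, (forall d, d \in J -> d = 0%N \/ d \in gammas sY),
        perm_eq (star n sX sY) ([seq (true, d.+1) | d <- J] ++ R),
        perm_eq (sY ++ nseq k (false, 0%N)) ([seq (false, d) | d <- J] ++ S) &
        mext (Nsum K sX) (Nsum K R) (Nsum K S)].
Proof.
elim: sY sX n => [|[b' c] sY IH] sX n posX posY sorted_Y.
  exists (nseq n 0%N), sX, [::], n; split.
  - by rewrite size_nseq.
  - by move=> d; rewrite mem_nseq => /andP[_ /eqP->]; left.
  - have -> : star n sX [::] = sX ++ nseq n (true, 1%N) by case: sX {posX} => [|[]].
    by rewrite map_nseq perm_catC.
  - by rewrite map_nseq cats0.
  - exact: mext_mzeror.
have posY' e' : e' \in sY -> (0 < e'.2)%N.
  by move=> eY; rewrite posY // inE eY orbT.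
have /= c_gt0 := posY _ (mem_head _ _).
have sorted_Y' : sorted geq (gammas sY) by apply: path_sorted sorted_Y.
have head_Y := sorted_geq_head sorted_Y.
have memY d : d = 0%N \/ d \in gammas sY ->
    d = 0%N \/ d \in gammas ((b', c) :: sY).
  by case=> [|dY]; [left | right; rewrite inE dY orbT].
case: sX posX => [|[b m] sX] posX.
  have pos0 e : e \in [::] -> (0 < (e : bool * nat).2)%N by [].
  case: (boolP (~~ b' && (0 < n)%N)) => [/andP[b'F n_gt0]|served].
    have b'E := negbTE b'F; subst b'; case: n n_gt0 => // n _.
    have [J [R [S [k [sJ JY pR pS ext]]]]] :=
      IH [::] n pos0 posY' sorted_Y'.
    exists (c :: J), R, S, k; split=> //=.
    - by rewrite sJ.
    - move=> d; rewrite inE => /orP[/eqP->|/JY]; last exact: memY.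
      by right; rewrite /= subn0 mem_head.
    - by rewrite /= addn1 subn1 perm_cons.
    - by rewrite perm_cons.
  have [J [R [S [k [sJ JY pR pS ext]]]]] :=
      IH [::] n pos0 posY' sorted_Y'.
  exists J, ((b', c) :: R), ((b', c) :: S), k; split=> //.
  - by move=> d /JY; apply: memY.
  - by rewrite orbF addn0 subn0; apply: perm_cons_cat.
  - exact: perm_cons_cat.
  - have e0 : miso (msum (mzero K) (mzero K)) (mzero K).
      have r0 := @regular_mzero K; apply: miso_of_dims => // [|n'|n'].
      - exact: regular_msum.
      - by rewrite kdim_msum kdim_mzero.
      - by rewrite mdim_msum mdim_mzero.
    apply: mext_miso (mext_msum (mext_mzerol (cyc K (b', c))) ext) => //.
    - exact: miso_refl.
    - exact: miso_refl.
have posX' e' : e' \in sX -> (0 < e'.2)%N.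
  by move=> eX; rewrite posX // inE eX orbT.
have /= m_gt0 := posX _ (mem_head _ _).
case: b' memY head_Y posY sorted_Y => memY head_Y posY sorted_Y; last first.
  have [J [R [S [k [sJ JY pR pS ext]]]]] := IH sX n posX' posY' sorted_Y'.
  exists J, ((b, (m + c)%N) :: R), ((false, c) :: S), k; split=> //.
  - by move=> d /JY; apply: memY.
  - by move: pR; rewrite /= addn0 subn0; apply: perm_cons_cat.
  - exact: perm_cons_cat.
  - by apply: mext_msum ext; apply: mext_concat.
have [[|d J] [R [S [k [sJ JY pR pS ext]]]]] := IH sX n.+1 posX' posY' sorted_Y' => //.
exists J, [:: (b, (m + c.-1)%N), (true, d.+1) & R],
  [:: (true, c), (false, d) & S], k; split.
- by case: sJ.
- by move=> d' d'J; apply/memY/JY; rewrite in_cons d'J orbT.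
- rewrite /= addn1 subn1; apply/perm_cons_cat/(perm_trans pR).
  exact: perm_cons_cat (perm_refl _).
- apply/perm_cons_cat/(perm_trans pS); exact: perm_cons_cat (perm_refl _).
have d_c : (d < c)%N.
  have [->//|/head_Y/=] := JY d (mem_head _ _).
  by rewrite subn1 => d_le; rewrite -(prednK c_gt0) ltnS.
have reg e := regular_cyc K e; have regN s := regular_Nsum K s.
apply: mext_miso (mext_msum (mext_exchange K b m_gt0 d_c) ext).
- exact: miso_refl.
- exact: miso_msumA.
- exact: miso_msumA.
Qed.

Theorem mext_star sX sY : standard sX -> standard sY ->
  mext (Nsum K sX) (Nsum K (star 0 sX sY)) (Nsum K sY).
Proof.
move=> std_X std_Y; have posX := standard_pos std_X; have posY := standard_pos std_Y.
have [J [R [S [k [/size0nil J0 _ pR pS ext]]]]] :=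
  star_matching 0 posX posY (standard_gammas std_Y).
rewrite {}J0 /= in pR pS.
have proper s : (forall e, e \in s -> 0 < e.2)%N ->
    all (fun e : bool * nat => e.1 <= e.2)%N s.
  by move=> pos; apply/allP=> e /pos; case: e.1.
apply: mext_miso ext; first exact: miso_refl.
  apply: miso_sym; apply: (@miso_Nsum_perm K _ _ 0); last by rewrite cats0.
  by apply: proper; apply: star_pos.
by apply: miso_sym; apply: miso_Nsum_perm pS; apply: proper.
Qed.

(** The second and third bounds of [mext_bounds] are sharp for [star 0 sX sY],
    the former where all marks that have arrived are served, the latter where
    every position beyond the blocks of [X] has served one. *)
Theorem star_generic sX sY t : standard sX -> standard sY -> standard t ->
    mext (Nsum K sX) (Nsum K t) (Nsum K sY) ->
  let z := star 0 sX sY in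
  (hdim z z <= hdim t t)%N /\ (hdim z z = hdim t t -> z = t).
Proof.
move=> std_X std_Y std_t ext z.
have posX := standard_pos std_X; have posY := standard_pos std_Y.
have std_z : standard z by apply: standard_star.
have [totz marksz] := mext_dims std_X std_Y std_z (mext_star std_X std_Y).
have [tott markst] := mext_dims std_X std_Y std_t ext.
have bounds := mext_bounds std_X std_Y std_t ext.
have le_b : forall n, (tsum (betas z) n <= tsum (betas t) n)%N.
  apply: tsum_le_top; rewrite ?standard_betas ?totz ?tott // => k.
  rewrite top_betas_star // add0n; have [_ b2 b3] := bounds k.
  case: (leqP k (size sX)) => kX; first by move: b3; lia.
  have topX : top k (betas sX) = sumn (betas sX).
    by rewrite /top take_oversize // size_map ltnW.
  have := top_betas k posY.
  have : (nmarks (take k sY) <= nmarks sY)%N.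
    by rewrite -{2}(cat_take_drop k sY) nmarks_cat leq_addr.
  move: b2 b3; lia.
have le_g : forall n, (tsum (gammas z) n <= tsum (gammas t) n)%N.
  apply: tsum_le_top; first exact: standard_gammas.
    have := sumn_betas (standard_pos std_z); have := sumn_betas (standard_pos std_t).
    rewrite totz tott marksz markst; lia.
  by move=> k; rewrite top_gammas_star //; have [] := bounds k.
have eq_m : nmarks z = nmarks t by rewrite marksz markst.
have eq_t : sumn (betas z) = sumn (betas t) by rewrite totz tott.
by split; [apply: hdim_min | apply: hdim_min_eq].
Qed.

End StarExtension.

(** * From triples to marked operators *)

Section Triples.

Variable K : fieldType.
Implicit Types (X Y Z : triple K).

Definition marked_of Z : marked K := Marked (Tmul K (be Z)) (limg (emb Z)).

Lemma in_qpoly_Xn (m n : nat) : (0 < m <= n)%N ->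
  in_qpoly 'X^m ('X^n : {poly K}) = 0.
Proof.
case/andP=> m_gt0 /subnK<-; rewrite exprD in_qpolyM.
suff -> : in_qpoly 'X^m ('X^m : {poly K}) = 0 by rewrite mulr0.
apply: val_inj => /=; case: m m_gt0 => // m _; rewrite mk_monic_Xn.
exact: Pdiv.RingMonic.rmodpp (monicXn _ _).
Qed.

Lemma in_qpoly_val (m : nat) (p : {poly K}) : (0 < m)%N -> (size p <= m)%N ->
  in_qpoly 'X^m p = p :> {poly K}.
Proof.
case: m => // m _ sp; apply: in_qpoly_small.
by rewrite mk_monic_Xn size_polyXn ltnS.
Qed.

Lemma shiftn_marked_of Z n (x : kmod K (be Z)) :
  shiftn (marked_of Z) n x = act 'X^n x.
Proof.
elim: n x => [|n IH] x; first by rewrite shiftn0 expr0 -[1]/(1%:P) actC scale1r.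
by rewrite shiftnS IH exprSr actM /= /shift /= lfunE.
Qed.

Lemma act_nilp (l : seq nat) (x : kmod K l) : (0%N \notin l) ->
  act 'X^(sumn l) x = 0.
Proof.
elim: l x => [|m l IH] x /=; first by move=> _; apply/rowP; case.
rewrite inE negb_or eq_sym -lt0n => /andP[m_gt0 l0]; congr pair.
  by rewrite in_qpoly_Xn ?mul0r // m_gt0 leq_addr.
by rewrite exprD actM IH // linear0.
Qed.

Lemma act_nilp1 (m : nat) (x : kmod K [:: m]) : (0 < m)%N -> act 'X^m x = 0.
Proof.
move=> m_gt0; have := @act_nilp [:: m] x; rewrite /= addn0; apply.
by rewrite inE eq_sym -lt0n.
Qed.

Lemma act_ones (l : seq nat) (x : kmod K l) :
  (forall m, m \in l -> m = 1%N) -> act 'X x = 0.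
Proof.
elim: l x => [|m l IH] x /=; first by move=> _; apply/rowP; case.
move=> l1; congr pair; last by apply: IH => m' m'l; apply: l1; rewrite inE m'l orbT.
have -> : in_qpoly 'X^m ('X : {poly K}) = 0; last by rewrite mul0r.
by rewrite (l1 m (mem_head _ _)) -[X in in_qpoly _ X]expr1 in_qpoly_Xn.
Qed.

Lemma in_S1_ones Z : in_S1 Z -> forall m, m \in al Z -> m = 1%N.
Proof.
case=> [[/andP[sorted_al al0] _ _ _]]; case: (al Z) sorted_al al0 => //= a l.
move=> al_sorted al0 a1 m ml.
have m_gt0 : (0 < m)%N by rewrite lt0n; apply: contraNneq al0 => <-.
have : (m <= a)%N.
  by move: ml; rewrite inE => /orP[/eqP->//|]; apply: (sorted_geq_head al_sorted).
lia.
Qed.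

Lemma regular_marked_of Z : in_S1 Z -> regular (marked_of Z).
Proof.
move=> S1Z; have [[_ /andP[_ be0] _ KT] _] := S1Z; split.
  by exists (sumn (be Z)) => x; rewrite shiftn_marked_of act_nilp.
move=> _ /memv_imgP[x _ ->]; rewrite /shift /= lfunE /= -KT act_ones ?linear0 //.
exact: in_S1_ones.
Qed.

Lemma equivariant_KT_hom X Y (f : 'Hom(marked_of X, marked_of Y)) :
  equivariant f <-> KT_hom f.
Proof.
split=> [ef|/KT_homP/lfunP cf x].
  by apply/KT_homP/lfunP=> x; rewrite !comp_lfunE ef.
by have := cf x; rewrite !comp_lfunE.
Qed.

(** Since the embeddings are injective, a morphism of triples is determined by
    its second component, which has to preserve the marks. *)
Definition lift_hom X Y (f : 'Hom(marked_of X, marked_of Y)) :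
    'Hom(kmod K (al X), kmod K (al Y)) * 'Hom(kmod K (be X), kmod K (be Y)) :=
  (((emb Y)^-1 \o f \o emb X)%VF, f).

Lemma lift_homE X Y (f : 'Hom(marked_of X, marked_of Y)) x :
    (forall u, u \in mark (marked_of X) -> f u \in mark (marked_of Y)) ->
  emb Y ((lift_hom f).1 x) = f (emb X x).
Proof.
move=> fU; rewrite !comp_lfunE limg_lfunVK //.
by apply: fU; apply: memv_img; apply: memvf.
Qed.

Lemma morphism_lift X Y (f : 'Hom(marked_of X, marked_of Y)) :
    in_S X -> in_S Y -> equivariant f ->
    (forall u, u \in mark (marked_of X) -> f u \in mark (marked_of Y)) ->
  morphism (lift_hom f).
Proof.
move=> [_ _ _ KTX] [_ _ injY KTY] /equivariant_KT_hom KTf fU; split=> //.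
  by move=> r x; apply: injY; rewrite lift_homE // KTX KTf KTY lift_homE.
by apply/lfunP=> x; rewrite [LHS]comp_lfunE [RHS]comp_lfunE lift_homE.
Qed.

Lemma morphism_mark X Y u : @morphism K X Y u ->
  equivariant (u.2 : 'Hom(marked_of X, marked_of Y)) /\
  forall x, x \in mark (marked_of X) -> u.2 x \in mark (marked_of Y).
Proof.
case=> _ KTu /lfunP com; split; first exact/equivariant_KT_hom.
move=> _ /memv_imgP[x _ ->]; have := com x; rewrite !comp_lfunE => <-.
by rewrite memv_img ?memvf.
Qed.

Lemma miso_of_iso X Y : iso X Y -> miso (marked_of X) (marked_of Y).
Proof.
move=> [u [v [/morphism_mark[eu uU] /morphism_mark[ev vU] [_ vu] [_ uv]]]].
exists u.2, v.2; split=> // x.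
  by have /lfunP/(_ x) := vu; rewrite comp_lfunE id_lfunE.
by have /lfunP/(_ x) := uv; rewrite comp_lfunE id_lfunE.
Qed.

Lemma iso_of_miso X Y :
  in_S X -> in_S Y -> miso (marked_of X) (marked_of Y) -> iso X Y.
Proof.
move=> SX SY [h [k [eh hK kK hU kU]]]; have ek := miso_inv_equivariant eh hK kK.
have [_ _ injX _] := SX; have [_ _ injY _] := SY.
exists (lift_hom h), (lift_hom k); split; try exact: morphism_lift.
  split; apply/lfunP=> x; rewrite comp_lfunE id_lfunE.
    by apply: injX; rewrite !lift_homE // hK.
  exact: hK.
split; apply/lfunP=> x; rewrite comp_lfunE id_lfunE.
  by apply: injY; rewrite !lift_homE // kK.
exact: kK.
Qed.

Lemma dim_EndS Z :
  in_S Z -> \dim (EndS Z) = \dim (mhom (marked_of Z) (marked_of Z)).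
Proof.
move=> SZ; have [_ _ injZ _] := SZ.
pose F := linfun (@snd 'End(kmod K (al Z)) 'End(kmod K (be Z))).
apply: (dimv_bij (f := F)) => [u|u|f].
- move=> /mem_EndS/morphism_mark mu; rewrite lfunE.
  by apply: (proj2 (@mem_mhom K (marked_of Z) (marked_of Z) u.2)).
- rewrite lfunE => /mem_EndS[_ _ /lfunP com] u2; case: u u2 com => u1 u2 /= ->.
  move=> com; congr pair; apply/lfunP=> x; apply: injZ.
  by have := com x; rewrite !comp_lfunE !zero_lfunE linear0.
- move=> Hf; have [ef fU] := proj1 (@mem_mhom K (marked_of Z) (marked_of Z) f) Hf.
  exists (lift_hom f); last by rewrite lfunE.
  by apply/mem_EndS; apply: morphism_lift.
Qed.

Lemma mext_of_short_exact X Z Y : in_S Z -> in_S Y ->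
  (exists u v, @short_exact K X Z Y u v) ->
  mext (marked_of X) (marked_of Z) (marked_of Y).
Proof.
move=> [_ _ injZ _] [_ _ injY _] [u [v [mu mv [_ ex1 surj1] [inj2 ex2 surj2]]]].
have [eu uU] := morphism_mark mu; have [ev vU] := morphism_mark mv.
have [_ _ /lfunP comu] := mu; have [_ _ /lfunP comv] := mv.
have vu z : v.2 z = 0 <-> exists x, z = u.2 x.
  split=> [vz|[x ->]].
    have : z \in lker v.2 by rewrite memv_ker vz.
    by rewrite -ex2 => /memv_imgP[x _ ->]; exists x.
  by apply/eqP; rewrite -memv_ker -ex2 memv_img ?memvf.
have u_inj : injective u.2 by apply/lker0P/eqP.
exists u.2, v.2; split; split=> //.
- by apply: limg_full; exact: surj2.
- move=> x; apply/idP/idP; last exact: uU.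
  move=> /memv_imgP[z _ uxz].
  have : z \in lker v.1.
    rewrite memv_ker; apply/eqP/injY; rewrite linear0.
    have := comv z; rewrite !comp_lfunE => ->; rewrite -uxz.
    by apply/vu; exists x.
  rewrite -ex1 => /memv_imgP[a _ za]; apply/memv_imgP; exists a; first exact: memvf.
  by apply: u_inj; have := comu a; rewrite !comp_lfunE uxz za.
- move=> _ /memv_imgP[y _ ->].
  have : y \in limg v.1 by rewrite surj1 memvf.
  case/memv_imgP=> z _ ->; exists (emb Z z); first by rewrite memv_img ?memvf.
  by have := comv z; rewrite !comp_lfunE.
Qed.

Lemma short_exact_of_mext X Z Y : in_S X -> in_S Z -> in_S Y ->
  mext (marked_of X) (marked_of Z) (marked_of Y) ->
  exists u v, @short_exact K X Z Y u v.
Proof.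
move=> SX SZ SY [f [g [[ef eg f_inj fg] [g_surj fU gU gU']]]].
have [_ _ injX _] := SX; have [_ _ injZ _] := SZ; have [_ _ injY _] := SY.
have fU' u : u \in mark (marked_of X) -> f u \in mark (marked_of Z) by rewrite fU.
exists (lift_hom f), (lift_hom g); split; try exact: morphism_lift.
- split.
  + apply/eqP/lker0P => x x' fx; apply: injX; apply: f_inj.
    by rewrite -!lift_homE // fx.
  + apply/vspaceP=> z; rewrite memv_ker; apply/memv_imgP/eqP => [[x _ ->]|gz].
      apply: injY; rewrite !lift_homE // linear0; apply/fg.
      by exists (emb X x).
    have /fg[x zx] : g (emb Z z) = 0 by rewrite -lift_homE // gz linear0.
    have : x \in mark (marked_of X) by rewrite -fU -zx memv_img ?memvf.
    case/memv_imgP=> a _ xa; exists a; first exact: memvf.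
    by apply: injZ; rewrite lift_homE // -xa.
  + apply/vspaceP=> y; rewrite memvf.
    have [|z /memv_imgP[a _ ->] gz] := gU' (emb Y y); first by rewrite memv_img ?memvf.
    have -> : y = (lift_hom g).1 a by apply: injY; rewrite lift_homE.
    by rewrite memv_img ?memvf.
- split.
  + exact/eqP/lker0P.
  + apply/vspaceP=> z; rewrite memv_ker; apply/memv_imgP/eqP => [[x _ ->]|/fg[x ->]].
      by apply/fg; exists x.
    by exists x; rewrite ?memvf.
  + apply/vspaceP=> y; rewrite memvf; have [z <-] := g_surj y.
    by rewrite memv_img ?memvf.
Qed.

Definition obj_of (s : seq (bool * nat)) : triple K :=
  foldr (@dsum K) (zero_triple K) [seq Pind K e.1 e.2 | e : bool * nat <- s].

Lemma be_obj_of s : be (obj_of s) = betas s.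
Proof. by elim: s => [|[[] m] s IH] //=; rewrite -IH. Qed.

Lemma al_obj_of s : al (obj_of s) = nseq (nmarks s) 1%N.
Proof.
by elim: s => [|[[] m] s IH]; rewrite ?nmarks_nil ?nmarks_cons //= -IH.
Qed.

Lemma act_cat (r : {poly K}) l l' (x : kmod K l) (y : kmod K l') :
  act r (kmod_cat x y) = kmod_cat (act r x) (act r y).
Proof. by elim: l x => [//|m l IH] x /=; rewrite IH. Qed.

Lemma kmod_cat_inj l l' (x x' : kmod K l) (y y' : kmod K l') :
  kmod_cat x y = kmod_cat x' y' -> x = x' /\ y = y'.
Proof.
by move=> /(congr1 (@kmod_split K l l')); rewrite !kmod_catK => -[-> ->].
Qed.

Definition embedding Z := injective (emb Z) /\ KT_hom (emb Z).

Lemma embedding_dsum X Y : embedding X -> embedding Y -> embedding (dsum X Y).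
Proof.
move=> [injX KTX] [injY KTY]; split.
  move=> z z'; rewrite -[z]kmod_splitK -[z']kmod_splitK !dsumE.
  by move=> /kmod_cat_inj[/injX-> /injY->].
move=> r z; rewrite -[z]kmod_splitK act_cat !dsumE act_cat.
by rewrite KTX KTY.
Qed.

Lemma kmod0 (x : kmod K [::]) : x = 0.
Proof. by apply/rowP; case. Qed.

Lemma embedding0 Z : al Z = [::] -> embedding Z.
Proof.
case: Z => a b f /= a0; rewrite a0 in f *; split=> [x x' _|r x].
  by rewrite (kmod0 x) (kmod0 x').
by rewrite (kmod0 (act r x)) (kmod0 x) !linear0.
Qed.

Lemma kmod1E (x : kmod K [:: 1%N]) : exists c : K, x = c *: (1, 0).
Proof.
have sx : (size (x.1 : {poly K}) <= 1)%N.
  by apply: leq_trans (size_npoly x.1) _; rewrite mk_monic_Xn size_polyXn.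
have xc := size1_polyC sx; exists (x.1 : {poly K})`_0.
case: x sx xc => x y sx xc; congr pair; last by rewrite (kmod0 y) (kmod0 (_ *: _)).
apply: val_inj; rewrite [LHS]xc /=.
by rewrite -[RHS]/(_ *: 1%:P) -mul_polyC mulr1.
Qed.

Lemma P1_emb1 m : (0 < m)%N ->
  P1_emb m (1, 0) = shiftn (marked_of (P1 K m)) m.-1 (1, 0).
Proof.
move=> m_gt0; rewrite shiftn_marked_of /P1_emb /=; congr pair; rewrite [RHS]mulr1.
by congr in_qpoly; apply: mulr1.
Qed.

Lemma P1_emb1_neq0 m : (0 < m)%N -> P1_emb m (1, 0) != 0 :> kmod K [:: m].
Proof.
move=> m_gt0; apply/eqP=> /(congr1 fst) E.
have : in_qpoly 'X^m ('X^(m.-1) : {poly K}) = 0 :> {poly K}.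
  by rewrite -[X in in_qpoly _ X]mulr1; apply: (congr1 (@polyn _ _) E).
rewrite (in_qpoly_val m_gt0) ?size_polyXn ?prednK // => /eqP.
by rewrite -size_poly_eq0 size_polyXn.
Qed.

Lemma P1E m (x : kmod K [:: 1%N]) : emb (P1 K m) x = P1_emb m x.
Proof. exact: lfunE. Qed.

Lemma P1Z m c (x : kmod K [:: 1%N]) : emb (P1 K m) (c *: x) = c *: P1_emb m x.
Proof. by rewrite -P1E linearZ. Qed.

Lemma embedding_P1 m : (0 < m)%N -> embedding (P1 K m).
Proof.
move=> m_gt0; split.
  apply/lker0P; rewrite -subv0; apply/subvP=> x; rewrite memv_ker memv0.
  have [c ->] := kmod1E x; rewrite P1Z.
  by rewrite !scaler_eq0 (negPf (P1_emb1_neq0 m_gt0)) orbF => ->.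
apply/KT_homP/lfunP=> x; rewrite !comp_lfunE.
have -> : Tmul K [:: 1%N] x = 0.
  by rewrite lfunE; apply: act_ones => m'; rewrite inE => /eqP.
have T0 : shift (marked_of (P1 K m)) (shiftn (marked_of (P1 K m)) m.-1 (1, 0)) = 0.
  by rewrite -shiftSn shiftn_marked_of prednK // act_nilp1.
rewrite linear0; have [c ->] := kmod1E x; rewrite P1Z P1_emb1 //.
transitivity (c *: (0 : kmod K [:: m])); first by rewrite scaler0.
by rewrite -[X in c *: X]T0; rewrite linearZ.
Qed.

Lemma embedding_obj_of (s : seq (bool * nat)) :
  (forall e, e \in s -> 0 < e.2)%N -> embedding (obj_of s).
Proof.
elim: s => [|[b m] s IH] pos; first exact: embedding0.
apply: embedding_dsum; last by apply: IH => e es; rewrite pos // inE es orbT.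
have /= m_gt0 := pos _ (mem_head _ _).
by case: b {pos}; [apply: embedding_P1 | apply: embedding0].
Qed.

Lemma in_S1_obj_of (s : seq (bool * nat)) : standard s -> in_S1 (obj_of s).
Proof.
move=> std_s; have pos := standard_pos std_s.
have [inj KT] := embedding_obj_of pos; split; last first.
  by rewrite al_obj_of nth_nseq; case: ifP.
split=> //.
  rewrite al_obj_of /is_part mem_nseq andbF andbT.
  by elim: (nmarks s) => // -[|n] //= ->.
rewrite be_obj_of /is_part standard_betas //=.
by apply/mapP=> -[e /pos e_gt0 e0]; rewrite -e0 in e_gt0.
Qed.

Lemma miso_dsum X Y : embedding X -> embedding Y ->
  miso (msum (marked_of X) (marked_of Y)) (marked_of (dsum X Y)).
Proof.
move=> embX embY.
have h_lin : linear (fun z : msum (marked_of X) (marked_of Y) =>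
    kmod_cat z.1 z.2 : kmod K (be X ++ be Y)).
  by move=> c z z'; rewrite -kmod_cat_linear.
have [h hE] := lfun_of_linear h_lin.
apply: (@misoI _ (msum (marked_of X) (marked_of Y)) (marked_of (dsum X Y)) h).
- by move=> z; rewrite !hE shift_msum /shift /= !lfunE /= act_cat.
- by move=> [x y] [x' y']; rewrite !hE => /kmod_cat_inj[/= -> ->].
- move=> z; exists (kmod_split z); rewrite hE; exact: kmod_splitK.
- move=> z; rewrite hE mem_mark_msum; apply/memv_imgP/andP.
    case=> a _; rewrite -[a]kmod_splitK dsumE => /kmod_cat_inj[-> ->].
    by rewrite !memv_img ?memvf.
  case=> /memv_imgP[a _ ->] /memv_imgP[a' _ ->].
  by exists (kmod_cat a a'); rewrite ?memvf // dsumE.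
Qed.

Lemma dim_kmod1 m : (0 < m)%N -> \dim {: kmod K [:: m]} = m.
Proof.
move=> m_gt0.
transitivity (\dim (prodv {: {poly %/ ('X^m : {poly K})}} {: 'rV[K]_0})).
  by congr (\dim _); apply/vspaceP=> x; rewrite mem_prodv !memvf.
rewrite dim_prodv [X in (X + _)%N](dim_polyn K) mk_monic_Xn size_polyXn.
by rewrite dimvf [X in (_ + X)%N](dim_matrix K 1 0) addn0 prednK.
Qed.

(** By the universal property of [cyc]: the class of 1 in [K[T]/(T^m)] is a
    generator of order [m]. *)
Lemma miso_Pind b m : (0 < m)%N -> miso (cyc K (b, m)) (marked_of (Pind K b m)).
Proof.
move=> m_gt0; have main (P := marked_of (Pind K b m)) (y : P) :
    shiftn P m y = 0 -> shiftn P m.-1 y != 0 -> \dim {: P} = m ->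
    (forall x, x \in mark P <->
       exists c : K, x = (c *+ b) *: shiftn P m.-1 y) ->
    miso (cyc K (b, m)) P.
  move=> Ty Tyn0 dimP markP.
  have [h [eh hy]] := @cyc_hom K (b, m) P y Ty.
  have h_inj : injective h by apply: (cyc_hom_inj eh m_gt0); rewrite hy.
  apply: (misoI eh h_inj).
    apply: limg_full; apply/eqP; rewrite eqEdim subvf dimv_inj //.
    by rewrite dimP dim_cyc leqnn.
  move=> x; rewrite mem_mark_cyc; apply/idP/idP => [/markP[c hx]|].
    have {hx} : x = (c *+ b) *: shiftn (cyc K (b, m)) m.-1 (gen K (b, m)).
      by apply: h_inj; rewrite hx linearZ /= (equivariantn _ _ eh) hy.
    move=> ->; case: (b) => /=; last by rewrite mulr0n scale0r eqxx.
    by rewrite linearZ /= -shiftSn prednK // gen_order scaler0 eqxx orbT.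
  case/orP=> [/eqP->|/andP[bT /eqP/cyc_ker[c ->]]]; first by rewrite linear0 mem0v.
  apply/markP; exists c.
  by rewrite linearZ /= (equivariantn _ _ eh) hy (_ : b = true).
case: b main => main.
  apply: (main (1, 0)).
  - by rewrite shiftn_marked_of; apply: act_nilp1.
  - by rewrite -P1_emb1 //; apply: P1_emb1_neq0.
  - exact: dim_kmod1.
  - move=> x; split=> [/memv_imgP[a _ ->]|[c ->]].
      have [c ->] := kmod1E a; exists c.
      by rewrite P1Z -P1_emb1.
    by rewrite -P1_emb1 // -P1E memvZ // memv_img ?memvf.
apply: (main (1, 0)).
- by rewrite shiftn_marked_of; apply: act_nilp1.
- have := P1_emb1_neq0 m_gt0; rewrite P1_emb1 // !shiftn_marked_of; exact.
- exact: dim_kmod1.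
- move=> x; split=> [/memv_imgP[a _ ->]|[c ->]].
    by exists 0; rewrite mul0rn scale0r (kmod0 a) linear0.
  by rewrite mulr0n scale0r mem0v.
Qed.

Lemma miso_obj_of (s : seq (bool * nat)) :
  (forall e, e \in s -> 0 < e.2)%N -> miso (Nsum K s) (marked_of (obj_of s)).
Proof.
elim: s => [|[b m] s IH] pos.
  apply: (@misoI _ (mzero K) (marked_of (zero_triple K)) \1%VF) => [x|x y|y|x].
  - exact: etrans (kmod0 _) (esym (kmod0 _)).
  - by rewrite (mzero0 x) (mzero0 y).
  - by exists 0; rewrite (kmod0 y) linear0.
  - by rewrite (mzero0 x) linear0 !mem0v.
have /= m_gt0 := pos _ (mem_head _ _).
have pos' e : e \in s -> (0 < e.2)%N by move=> es; rewrite pos // inE es orbT.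
apply: miso_trans (miso_msum (miso_Pind b m_gt0) (IH pos')) _.
apply: miso_dsum; last exact: embedding_obj_of.
by case: b {pos}; [apply: embedding_P1 | apply: embedding0].
Qed.

End Triples.

(** * From pairs of partitions to lists of blocks *)

Section Pairs.

Local Open Scope nat_scope.
Implicit Types (g b : seq nat).

Definition pairs g b : seq (bool * nat) :=
  [seq (nth 0 b i - nth 0 g i != 0, nth 0 b i) | i <- iota 0 (size b)].

Lemma betas_pairs g b : betas (pairs g b) = b.
Proof. by rewrite /betas -map_comp; apply: mkseq_nth. Qed.

Lemma size_pairs g b : size (pairs g b) = size b.
Proof. by rewrite size_map size_iota. Qed.

Lemma nth_pairs g b i : i < size b ->
  nth (false, 0) (pairs g b) i = (nth 0 b i - nth 0 g i != 0, nth 0 b i).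
Proof. by move=> i_lt; rewrite (nth_map 0) ?size_iota // nth_iota. Qed.

Lemma nth_gammas_pairs g b i :
    (forall j, nth 0 g j <= nth 0 b j <= (nth 0 g j).+1) ->
  nth 0 (gammas (pairs g b)) i = nth 0 g i.
Proof.
move=> gb; have gbi := gb i.
case: (ltnP i (size b)) => [i_lt|i_ge].
  by rewrite (nth_map (false, 0)) ?size_pairs // nth_pairs //=; lia.
rewrite nth_default ?size_map ?size_iota //.
by move: gbi; rewrite (nth_default 0 i_ge) leqn0 => /andP[/eqP->].
Qed.

Lemma sorted_nth l : (forall i, nth 0 l i.+1 <= nth 0 l i) -> sorted geq l.
Proof. by move=> sl; apply/(sortedP 0) => i _; apply: sl. Qed.

Lemma nth_part g i : is_part g -> i < size g -> 0 < nth 0 g i.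
Proof.
case/andP=> _ g0 i_lt; rewrite lt0n; apply: contraNneq g0 => <-.
exact: mem_nth.
Qed.

Lemma standard_pairs g b : S1_pair g b -> standard (pairs g b).
Proof.
move=> [/andP[sg _] part_b gb]; have [sb _] := andP part_b.
apply/andP; split; last first.
  apply/(all_nthP (false, 0)) => i; rewrite size_pairs => i_lt.
  by rewrite nth_pairs //= nth_part.
apply/(sortedP (false, 0)) => i; rewrite size_pairs => i_lt.
rewrite !nth_pairs ?(ltnW i_lt) // /dominates /=.
have := nth_geq i sg; have := nth_geq i sb; have := gb i; have := gb i.+1; lia.
Qed.

Lemma pairs_unique (s : seq (bool * nat)) g : standard s ->
  (forall i, nth 0 g i = nth 0 (gammas s) i) -> pairs g (betas s) = s.
Proof.
move=> std_s gE; have pos := standard_pos std_s.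
have gb i : nth 0 g i <= nth 0 (betas s) i <= (nth 0 g i).+1.
  by rewrite gE (nth_betas_gammas _ pos) -addn1 leq_addr leq_add2l leq_b1.
have sizeE : size (pairs g (betas s)) = size s by rewrite size_pairs size_map.
apply: (eq_from_nth (x0 := (false, 0))) => // i; rewrite sizeE => i_lt.
rewrite nth_pairs ?size_map // gE (nth_betas_gammas _ pos) addKn.
rewrite -(nth_betas_gammas _ pos) (nth_map (false, 0)) //.
by case: (nth _ s i) => [[] m].
Qed.

Section Algorithm.

Variables (sX sY : seq (bool * nat)) (gX gY : seq nat).
Hypotheses (std_X : standard sX) (std_Y : standard sY).
Hypothesis gXE : forall i, nth 0 gX i = nth 0 (gammas sX) i.
Hypothesis gYE : forall i, nth 0 gY i = nth 0 (gammas sY) i.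

Let posX := standard_pos std_X.
Let posY := standard_pos std_Y.
Let bX := betas sX.
Let bY := betas sY.

Lemma nth_bY i : nth 0 bY i = nth 0 gY i + (nth (false, 0) sY i).1.
Proof. by rewrite gYE -nth_betas_gammas. Qed.

Lemma step4_X_star d i acc n : i + d = size bX ->
  foldl (step4_X bX) (acc, n) (iota i d) = (acc ++ drop i bX, n).
Proof.
elim: d i acc => [|d IH] i acc /= id.
  by rewrite drop_oversize ?cats0 // -id addn0.
rewrite {2}/step4_X /= IH ?addSnnS // -cats1 -catA; congr (_ ++ _, _).
by rewrite [RHS](drop_nth 0) // -id; lia.
Qed.

Lemma step4_Y_star d i acc n : i + d = size sY ->
  let st := foldl (step4_Y gY bY) (acc, n) (iota i d) in
  st.1 ++ nseq st.2 1 = acc ++ betas (star n [::] (drop i sY)).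
Proof.
elim: d i acc n => [|d IH] i acc n /= id.
  rewrite drop_oversize; last by rewrite -id addn0.
  by rewrite /= /betas map_nseq.
have i_lt : i < size sY by rewrite -id; lia.
rewrite (drop_nth (false, 0) i_lt) /step4_Y /= nth_bY.
have := nth_bY i; rewrite /bY (nth_map (false, 0)) //.
case: (nth _ sY i) => [b c] /= ->.
have -> : (nth 0 gY i == nth 0 gY i + b) = ~~ b by case: b; lia.
rewrite IH ?addSnnS // -cats1 -catA /=.
by case: (~~ b && _).
Qed.

(** The state of the algorithm before round [i] of its third step, in terms of
    [star]: the parts [acc] are final, and the rest depends only on the counter
    [n] and on the blocks of index at least [i]. *)
Lemma step3_star d i acc n : minn (size bX) (size bY) - i = d ->
    i <= minn (size bX) (size bY) ->
  let st3 := foldl (step3 bX gY bY) (acc, n) (iota i d) in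
  let st4 := if minn (size bX) (size bY) < size bX
    then foldl (step4_X bX) st3
           (iota (minn (size bX) (size bY)) (size bX - minn (size bX) (size bY)))
    else foldl (step4_Y gY bY) st3
           (iota (minn (size bX) (size bY)) (size bY - minn (size bX) (size bY))) in
  st4.1 ++ nseq st4.2 1 = acc ++ betas (star n (drop i sX) (drop i sY)).
Proof.
have sbX : size bX = size sX by rewrite size_map.
have sbY : size bY = size sY by rewrite size_map.
elim: d i acc n => [|d IH] i acc n im i_le.
  have {im i_le} -> : i = minn (size bX) (size bY) by lia.
  rewrite /=; set m := minn _ _; case: ltnP => [m_lt|m_ge].
    rewrite step4_X_star /=; last by rewrite subnKC // ltnW.
    rewrite (@drop_oversize _ m sY) -?sbY; last by rewrite /m in m_lt *; lia.
    have -> : star n (drop m sX) [::] = drop m sX ++ nseq n (true, 1).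
      by case: (drop m sX) => [|[]].
    by rewrite /betas map_cat map_nseq map_drop catA.
  rewrite step4_Y_star; last by rewrite -sbY subnKC // geq_minr.
  by rewrite (@drop_oversize _ m sX) // -sbX.
have iX : i < size sX by rewrite -sbX; lia.
have iY : i < size sY by rewrite -sbY; lia.
rewrite (drop_nth (false, 0) iX) (drop_nth (false, 0) iY).
rewrite /= IH; try lia.
have bXE : nth 0 bX i = (nth (false, 0) sX i).2 by rewrite (nth_map (false, 0)).
have bYE : nth 0 bY i = (nth (false, 0) sY i).2 by rewrite (nth_map (false, 0)).
have := nth_bY i; rewrite {1}bYE nth_bY bXE.
case: (nth _ sX i) => b m; case: (nth _ sY i) => b' c /= ->.
have -> : (if nth 0 gY i + b' != nth 0 gY i then n.+1 else n) = n + b'.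
  by case: b'; rewrite ?addn0 ?eqxx // !addn1 (gtn_eqF (ltnSn _)).
by rewrite -cats1 -catA addnK.
Qed.

Lemma algo_beta_star : algo_beta bX gY bY = betas (star 0 sX sY).
Proof.
have := @step3_star (minn (size bX) (size bY)) 0 [::] 0 (subn0 _) (leq0n _).
by rewrite !drop0.
Qed.

Lemma nth_algo_gamma i :
  nth 0 (algo_gamma gX gY) i = nth 0 (gammas (star 0 sX sY)) i.
Proof.
rewrite nth_gammas_star // -gXE -gYE /algo_gamma /step1.
case: (ltnP i (maxn (size gX) (size gY))) => [i_lt|]; first by rewrite nth_mkseq.
by move=> i_ge; rewrite !nth_default ?size_mkseq //; lia.
Qed.

End Algorithm.

Lemma S1_pair_algo gX bX gY bY : S1_pair gX bX -> S1_pair gY bY ->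
  S1_pair (algo_gamma gX gY) (algo_beta bX gY bY) /\
  pairs (algo_gamma gX gY) (algo_beta bX gY bY)
    = star 0 (pairs gX bX) (pairs gY bY).
Proof.
move=> pX pY; have std_X := standard_pairs pX; have std_Y := standard_pairs pY.
have [part_gX part_bX gbX] := pX; have [part_gY part_bY gbY] := pY.
have gXE i : nth 0 gX i = nth 0 (gammas (pairs gX bX)) i.
  by rewrite nth_gammas_pairs.
have gYE i : nth 0 gY i = nth 0 (gammas (pairs gY bY)) i.
  by rewrite nth_gammas_pairs.
have std_Z := standard_star std_X std_Y.
have bZE := algo_beta_star (pairs gX bX) std_Y gYE.
rewrite !betas_pairs in bZE.
have gZE := nth_algo_gamma std_X std_Y gXE gYE.
rewrite bZE pairs_unique //; split=> //; split.
- apply/andP; split.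
    by apply: sorted_nth => i; rewrite !gZE nth_geq ?standard_gammas.
  rewrite /algo_gamma /step1; apply/mapP => -[i]; rewrite mem_iota add0n /=.
  rewrite leq_max => /orP[]/nth_part; [move=> /(_ part_gX)|move=> /(_ part_gY)]; lia.
- rewrite /is_part standard_betas //=; apply/mapP => -[e /(standard_pos std_Z)].
  by move=> + e0; rewrite -e0.
- move=> i; rewrite gZE (nth_betas_gammas _ (standard_pos std_Z)).
  by rewrite -addn1 leq_addr leq_add2l leq_b1.
Qed.

End Pairs.

(** * The theorem *)

Section Main.

Variable K : fieldType.

Lemma obj_pairs g b : obj K g b = obj_of K (pairs g b).
Proof.
rewrite /obj /obj_of /pairs -map_comp; congr foldr; apply: eq_map => i /=.
by rewrite /Pind; case: eqP.
Qed.

Lemma miso_given_by (X : triple K) g b : given_by X g b ->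
  standard (pairs g b) /\ miso (marked_of X) (Nsum K (pairs g b)).
Proof.
move=> [pgb isoX]; have std := standard_pairs pgb; split=> //.
apply: miso_trans (miso_of_iso isoX) _; rewrite obj_pairs.
by apply: miso_sym; apply: miso_obj_of; apply: standard_pos.
Qed.

Lemma dim_EndS_standard (Z : triple K) t : in_S1 Z -> standard t ->
  miso (Nsum K t) (marked_of Z) -> \dim (EndS Z) = hdim t t.
Proof.
move=> [SZ _] /standard_pos pos_t iZ.
by rewrite dim_EndS // -(dim_mhom_miso iZ) dim_mhom_Nsum.
Qed.

End Main.

Theorem corollary5p12 (K : closedFieldType) (X Y : triple K)
    (gX bX gY bY : seq nat) :
  in_S1 X -> in_S1 Y ->
  given_by X gX bX -> given_by Y gY bY ->
  let gZ := algo_gamma gX gY in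
  let bZ := algo_beta bX gY bY in
  S1_pair gZ bZ /\ generic_extension Y X (obj K gZ bZ).
Proof.
move=> [SX _] [SY _] genX genY gZ bZ.
have [pairZ pairsZ] := S1_pair_algo genX.1 genY.1; split=> //.
have [std_X isoX] := miso_given_by genX; have [std_Y isoY] := miso_given_by genY.
set sX := pairs gX bX in std_X isoX pairsZ.
set sY := pairs gY bY in std_Y isoY pairsZ.
set z := star 0 sX sY in pairsZ.
have std_z : standard z := standard_star std_X std_Y.
rewrite obj_pairs pairsZ.
have S1Z := in_S1_obj_of K std_z; have [SZ _] := S1Z.
have isoZ := miso_obj_of K (standard_pos std_z).
have extZ : extension Y X (obj_of K z).
  split=> //; apply: short_exact_of_mext => //.
  exact: mext_miso (miso_sym isoX) isoZ (miso_sym isoY) (mext_star K std_X std_Y).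
have compare Z' : extension Y X Z' -> exists t,
    [/\ standard t, miso (Nsum K t) (marked_of Z'), \dim (EndS Z') = hdim t t,
        (hdim z z <= hdim t t)%N & hdim z z = hdim t t -> z = t].
  move=> [S1Z' exZ']; have [SZ' _] := S1Z'.
  have [t std_t isot] := decompose (regular_marked_of S1Z').
  have ext := mext_of_short_exact SZ' SY exZ'.
  have [//|min_z eq_z] := star_generic (K := K) std_X std_Y std_t.
    exact: mext_miso isoX (miso_sym isot) isoY ext.
  by exists t; split=> //; apply: dim_EndS_standard.
have dimZ := dim_EndS_standard S1Z std_z isoZ.
split; first split=> // Z' /compare[t [_ _ -> + _]]; first by rewrite dimZ.
move=> Z' [extZ' minZ']; have [t [_ isot dimt le_t eq_t]] := compare Z' extZ'.
have := minZ' _ extZ; rewrite dimZ dimt => ge_t.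
have zt : z = t by apply: eq_t; apply/eqP; rewrite eqn_leq le_t.
apply: iso_of_miso => //; first by case: extZ' => -[].
by apply: miso_trans (miso_sym isot) _; rewrite -zt.
Qed.
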